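(* Let $p,q$ be nonnegative integers, let $\kappa_1,\dots,\kappa_p,\mu_1,\dots,\mu_q$ be complex numbers none of which is in $\{0,-1,-2,\dots\}$, let $\alpha,\beta\in\mathbb{C}$ with $\Re(\alpha)>0$, let $\lambda_1,\lambda_2,\lambda_3\in\mathbb{C}$ with $\Re(\lambda_3)>\Re(\lambda_2)>0$, let $s\in\mathbb{C}$ with $\Re(s)>0$, and let $z\in\mathbb{C}$ with $|z|<1$. Then the Mellin transform in $\rho$ of the M-Gauss hypergeometric function is $$\int_0^\infty\rho^{s-1}\;{}^{M}F_{p,q}^{(\alpha,\beta)}(\lambda_{1},\lambda_{2};\lambda_{3};z;\rho)\,d\rho =\frac{{}^{M}\Gamma_{p,q}^{(\alpha,\beta)}(s;0)\,B(\lambda_{2}+s,\lambda_{3}+s-\lambda_{2})}{B(\lambda_{2},\lambda_{3}-\lambda_{2})}\;{}_{2}F_{1}(\lambda_{1},\lambda_{2}+s;\lambda_{3}+2s;z).$$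
   Context: $(\lambda)_m=\Gamma(\lambda+m)/\Gamma(\lambda)$, $(\lambda)_0=1$ is the Pochhammer symbol, $B(x,y)=\int_0^1 t^{x-1}(1-t)^{y-1}dt$ is the classical beta function, and ${}_{2}F_{1}(\lambda_1,\lambda_2;\lambda_3;z)=\sum_{n\ge0} \frac{(\lambda_1)_n(\lambda_2)_{n}}{(\lambda_3)_{n}}\frac{z^n}{n!}$ for $|z|<1$. The generalized M-series is $${}_{p}^{\alpha}M^{\beta}_{q}(\kappa_{1},\ldots,\kappa_{p};\mu_{1},\ldots,\mu_{q};z)=\sum_{m=0}^{\infty}\frac{(\kappa_{1})_{m}\cdots(\kappa_p)_{m}}{(\mu_1)_{m}\cdots(\mu_q)_{m}}\frac{z^{m}}{\Gamma(\alpha m+\beta)}.$$ With parameters $\kappa_1,\dots,\kappa_p;\mu_1,\dots,\mu_q$ suppressed from the notation, the modified gamma (M-gamma), modified beta (M-beta) and modified Gauss hypergeometric (M-Gauss hypergeometric) functions are $${}^{M}\Gamma_{p,q}^{(\alpha,\beta)}(x;\rho)=\int_{0}^{\infty}t^{x-1}\,{}_{p}^{\alpha}M^{\beta}_{q}\left(\kappa_{1},\ldots,\kappa_{p};\mu_{1},\ldots,\mu_{q};-t-\frac{\rho}{t}\right) dt,$$ $${}^{M}B_{p,q}^{(\alpha,\beta)}(x,y;\rho)=\int_{0}^{1}t^{x-1}(1-t)^{y-1}\,{}_{p}^{\alpha}M^{\beta}_{q}\left(\kappa_{1},\ldots,\kappa_{p};\mu_{1},\ldots,\mu_{q};\frac{-\rho}{t(1-t)}\right)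 dt,$$ $${}^{M}F_{p,q}^{(\alpha,\beta)}(\lambda_1,\lambda_2;\lambda_3;z;\rho)=\sum_{n=0}^{\infty}(\lambda_1)_{n}\frac{{}^{M}B_{p,q}^{(\alpha,\beta)}(\lambda_2+n,\lambda_3-\lambda_2;\rho)}{B(\lambda_2,\lambda_3-\lambda_2)}\frac{z^{n}}{n!}.$$ These functions are defined for those parameters and arguments for which the series and integrals converge. *)

(* Defs.v *)
From Stdlib Require Import Reals ZArith Lra Lia.
From Coquelicot Require Import Coquelicot.
Open Scope R_scope.
Open Scope C_scope.

(** Improper integrals of complex-valued functions of a real variable are
    limits of Riemann integrals over compact subintervals, both endpoints
    being limits: only convergence, not absolute convergence, is required. *)
Definition ex_CInt_0oo (f : R -> C) : Prop :=
  @ex_RInt_gen C_R_NormedModule f (at_right 0) (Rbar_locally p_infty).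

Definition is_CInt_0oo (f : R -> C) (l : C) : Prop :=
  @is_RInt_gen C_R_NormedModule f (at_right 0) (Rbar_locally p_infty) l.

Definition CInt_0oo (f : R -> C) : C :=
  @RInt_gen C_R_CompleteNormedModule f (at_right 0) (Rbar_locally p_infty).

Definition ex_CInt_01 (f : R -> C) : Prop :=
  @ex_RInt_gen C_R_NormedModule f (at_right 0) (at_left 1).

Definition CInt_01 (f : R -> C) : C :=
  @RInt_gen C_R_CompleteNormedModule f (at_right 0) (at_left 1).

Definition ex_CSeries (a : nat -> C) : Prop :=
  @ex_series C_AbsRing C_NormedModule a.

(** Arbitrary if the series diverges. *)
Definition CSeries (a : nat -> C) : C :=
  @iota C_CompleteNormedModule (@is_series C_AbsRing C_NormedModule a).

Lemma CSeries_unique (a : nat -> C) (l : C) :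
  @is_series C_AbsRing C_NormedModule a l -> CSeries a = l.
Proof.
intros Hl.
apply (@iota_filterlim_locally C_AbsRing C_CompleteNormedModule nat eventually
         _ (sum_n a) l Hl).
Qed.

Definition Cexp (z : C) : C :=
  RtoC (exp (Re z)) * (cos (Im z), sin (Im z)).

(** [t ^ a] for [t > 0], with the real logarithm of [t]. *)
Definition Rpow_C (t : R) (a : C) : C := Cexp (a * RtoC (ln t)).

Fixpoint Cprod (f : nat -> C) (n : nat) : C :=
  match n with
  | O => 1
  | S k => Cprod f k * f k
  end.

(** The value of [Gamma (lambda + m) / Gamma lambda], in the form that also
    makes sense when [lambda] is a pole of [Gamma]. *)
Definition pochhammer (lambda : C) (m : nat) : C :=
  Cprod (fun k => lambda + RtoC (INR k)) m.

Definition Euler_Gamma (z : C) : C :=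
  CInt_0oo (fun t => Rpow_C t (z - 1) * RtoC (exp (- t))).

(** The least [n] such that [Re z + n > 0]. *)
Definition Gamma_shift (z : C) : nat := Z.to_nat (up (- Re z)).

(** Analytic continuation of Euler's integral by the functional equation.  At
    the poles the denominator vanishes and [x / 0 = 0], so that [/ Gamma z] is
    the entire function 1/Gamma on all of [C]. *)
Definition Gamma (z : C) : C :=
  Euler_Gamma (z + RtoC (INR (Gamma_shift z))) / pochhammer z (Gamma_shift z).

Lemma Gamma_shift_gt0 (z : C) : (0 < Re z + INR (Gamma_shift z))%R.
Proof.
unfold Gamma_shift.
destruct (archimed (- Re z)) as [H _].
destruct (Z_le_gt_dec 0 (up (- Re z))) as [H0|H0].
- rewrite INR_IZR_INZ, Z2Nat.id by assumption. lra.
- assert (H1 : (IZR (up (- Re z)) < 0)%R) by (apply IZR_lt; lia).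
  assert (H2 := pos_INR (Z.to_nat (up (- Re z)))). lra.
Qed.

Lemma Cinv_0 : / RtoC 0 = RtoC 0.
Proof.
unfold Cinv, RtoC; simpl; f_equal; unfold Rdiv; ring.
Qed.

Lemma Cprod_0 (f : nat -> C) (n k : nat) :
  (k < n)%nat -> f k = RtoC 0 -> Cprod f n = RtoC 0.
Proof.
intros Hk Hf; induction n as [|n IH]; [lia|].
simpl; destruct (Nat.eq_dec k n) as [->|Hne].
- rewrite Hf; ring.
- rewrite IH by lia; ring.
Qed.

Lemma inv_Gamma_pole (n : nat) : / Gamma (- RtoC (INR n)) = RtoC 0.
Proof.
assert (H : pochhammer (- RtoC (INR n)) (Gamma_shift (- RtoC (INR n)))
            = RtoC 0).
{ assert (H0 := Gamma_shift_gt0 (- RtoC (INR n))).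
  apply Cprod_0 with n.
  - apply INR_lt. simpl in H0. lra.
  - ring. }
unfold Gamma, Cdiv; rewrite H, Cinv_0, Cmult_0_r; apply Cinv_0.
Qed.

Definition Beta (x y : C) : C :=
  CInt_01 (fun t => Rpow_C t (x - 1) * Rpow_C (1 - t) (y - 1)).

Definition Gauss_2F1 (l1 l2 l3 z : C) : C :=
  CSeries (fun n =>
    pochhammer l1 n * pochhammer l2 n / pochhammer l3 n
    * (Cpow z n / RtoC (INR (fact n)))).

(** In the definitions below [kappa 0, ..., kappa (p - 1)] and
    [mu 0, ..., mu (q - 1)] are the parameters; the other values of these
    functions are not used. *)
Definition MSeries_term (p q : nat) (kappa mu : nat -> C) (alpha beta z : C)
    (m : nat) : C :=
  Cprod (fun i => pochhammer (kappa i) m) p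
  / Cprod (fun j => pochhammer (mu j) m) q
  * (Cpow z m / Gamma (alpha * RtoC (INR m) + beta)).

Definition ex_MSeries (p q : nat) (kappa mu : nat -> C) (alpha beta z : C)
    : Prop :=
  ex_CSeries (MSeries_term p q kappa mu alpha beta z).

Definition MSeries (p q : nat) (kappa mu : nat -> C) (alpha beta z : C) : C :=
  CSeries (MSeries_term p q kappa mu alpha beta z).

Definition MGamma_arg (rho : C) (t : R) : C := - RtoC t - rho / RtoC t.

Definition MGamma_integrand (p q : nat) (kappa mu : nat -> C)
    (alpha beta x rho : C) (t : R) : C :=
  Rpow_C t (x - 1) * MSeries p q kappa mu alpha beta (MGamma_arg rho t).

Definition ex_MGamma (p q : nat) (kappa mu : nat -> C)
    (alpha beta x rho : C) : Prop :=
  (forall t : R, (0 < t)%R ->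
     ex_MSeries p q kappa mu alpha beta (MGamma_arg rho t)) /\
  ex_CInt_0oo (MGamma_integrand p q kappa mu alpha beta x rho).

Definition MGamma (p q : nat) (kappa mu : nat -> C)
    (alpha beta x rho : C) : C :=
  CInt_0oo (MGamma_integrand p q kappa mu alpha beta x rho).

Definition MBeta_arg (rho : C) (t : R) : C := - rho / RtoC (t * (1 - t)).

Definition MBeta_integrand (p q : nat) (kappa mu : nat -> C)
    (alpha beta x y rho : C) (t : R) : C :=
  Rpow_C t (x - 1) * Rpow_C (1 - t) (y - 1)
  * MSeries p q kappa mu alpha beta (MBeta_arg rho t).

Definition ex_MBeta (p q : nat) (kappa mu : nat -> C)
    (alpha beta x y rho : C) : Prop :=
  (forall t : R, (0 < t < 1)%R ->
     ex_MSeries p q kappa mu alpha beta (MBeta_arg rho t)) /\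
  ex_CInt_01 (MBeta_integrand p q kappa mu alpha beta x y rho).

Definition MBeta (p q : nat) (kappa mu : nat -> C)
    (alpha beta x y rho : C) : C :=
  CInt_01 (MBeta_integrand p q kappa mu alpha beta x y rho).

Definition MGauss_term (p q : nat) (kappa mu : nat -> C)
    (alpha beta l1 l2 l3 z rho : C) (n : nat) : C :=
  pochhammer l1 n
  * (MBeta p q kappa mu alpha beta (l2 + RtoC (INR n)) (l3 - l2) rho
     / Beta l2 (l3 - l2))
  * (Cpow z n / RtoC (INR (fact n))).

Definition ex_MGauss (p q : nat) (kappa mu : nat -> C)
    (alpha beta l1 l2 l3 z rho : C) : Prop :=
  (forall n : nat,
     ex_MBeta p q kappa mu alpha beta (l2 + RtoC (INR n)) (l3 - l2) rho) /\
  ex_CSeries (MGauss_term p q kappa mu alpha beta l1 l2 l3 z rho).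

Definition MGauss (p q : nat) (kappa mu : nat -> C)
    (alpha beta l1 l2 l3 z rho : C) : C :=
  CSeries (MGauss_term p q kappa mu alpha beta l1 l2 l3 z rho).

(* Main.v *)
(** Put [phi v = M(-v)] and let [G v] be the integral of [u^(s-1) phi u] over
    [(0, v)].  This integral converges only conditionally at infinity, but [G] is
    bounded, tends to [MGamma s 0] and is [O(v^(Re s))].

    With [c = t (1 - t)], both [t]- and [rho]-derivatives of [G (rho / c)] are
    multiples of [phi (rho / c)].  The [t]-derivative gives, by integration by
    parts near the endpoints, the convergence of the modified beta integrals,
    locally uniformly in [rho] and with at most linear growth in [n].  The
    [rho]-derivative gives
      int_a^b rho^(s-1) MBeta (x, y; rho) drho
        = int_0^1 t^(x+s-1) (1-t)^(y+s-1) (G (b / c) - G (a / c)) dt,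
    which tends to [MGamma s 0 * Beta (x + s) (y + s)] because [b / c >= 4 b] and
    [|G (a / c)| <= K (a / c)^(Re s)], uniformly in [x = lambda2 + n].  The sum over
    [n] is then dominated, and [Beta (x + 1) y = x / (x + y) * Beta x y] turns it into
    the hypergeometric series. *)

Require Import Defs.
From Stdlib Require Import Reals Arith Lra Lia FunctionalExtensionality.
From Coquelicot Require Import Coquelicot.
Local Open Scope C_scope.
Local Open Scope R_scope.

(** * Calculus of complex-valued functions of a real variable *)

(** All the convergence in the conclusion is drawn from [ex_MGamma] at [rho = 0], that is from the
    M-series on the negative half-line and one improper integral. A power series that converges
    along a whole ray is entire, so [phi] is continuous on all of R and bounded near 0; this is what
    yields the bound [O(v^(Re s))] for [G]. The obstacle is the lack of absolute convergence:
    neither Fubini nor dominated convergence applies to the double integral. Every exchange of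
    limits is therefore made on compact sets, where the integrands are continuous, and the
    truncation to [[u, 1 - u]] is removed afterwards with an explicit rate [u^sigma]. Uniformity is
    read off the constants, which is why they are tracked throughout: in the rate for the modified
    beta integrals [rho] enters only through [rho^(- Re s)] and [n] only through [n + 1]. The linear
    growth in [n] has its source in the factor [lambda2 + n + s] produced by differentiating
    [t^(lambda2 + n + s)]. It is harmless because the sum of [|(lambda1)_n z^n / n!| (n + 1)] still
    converges for [|z| < 1]. *)

Notation Ccontinuous := (@continuous R_UniformSpace C_UniformSpace).
Notation Cderive := (@is_derive R_AbsRing C_R_NormedModule).
Notation CisRInt := (@is_RInt C_R_NormedModule).
Notation CRInt := (@RInt C_R_CompleteNormedModule).

(** The product norm on pairs is the Euclidean one, so the agreement with the modulus is exact. The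
    balls of the uniform structure are squares instead, which is why limits are converted through
    the norm below. *)
Lemma norm_Cmod (w : C) : @norm R_AbsRing C_R_NormedModule w = Cmod w.
Proof.
destruct w as [x y]; unfold norm; simpl; unfold prod_norm, Cmod; simpl.
unfold norm; simpl; unfold abs; simpl.
f_equal; rewrite !Rmult_1_r, <- !Rabs_mult, !Rabs_pos_eq; trivial; nra.
Qed.

Lemma Cmod_minus_le (a b : C) : Cmod (a - b)%C <= Cmod a + Cmod b.
Proof. unfold Cminus; eapply Rle_trans; [apply Cmod_triangle|]; rewrite Cmod_opp; lra. Qed.

Lemma Ccontinuous_pair (f : R -> C) (x : R) :
  continuous (fun t => Re (f t)) x -> continuous (fun t => Im (f t)) x ->
  Ccontinuous f x.
Proof.
intros H1 H2.
apply continuous_ext with (fun t => (Re (f t), Im (f t))).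
{ intros t; destruct (f t); reflexivity. }
apply (continuous_comp_2 (fun t => Re (f t)) (fun t => Im (f t)) (fun a b => (a, b)));
  trivial.
apply continuous_ext with (fun u : R * R => u); [now intros []|apply continuous_id].
Qed.

Lemma Ccontinuous_Re (f : R -> C) (x : R) :
  Ccontinuous f x -> continuous (fun t => Re (f t)) x.
Proof. intros H; apply (continuous_comp f fst); [exact H|apply continuous_fst]. Qed.

Lemma Ccontinuous_Im (f : R -> C) (x : R) :
  Ccontinuous f x -> continuous (fun t => Im (f t)) x.
Proof. intros H; apply (continuous_comp f snd); [exact H|apply continuous_snd]. Qed.

Lemma Ccontinuous_mult (f g : R -> C) (x : R) :
  Ccontinuous f x -> Ccontinuous g x -> Ccontinuous (fun t => (f t * g t)%C) x.
Proof.
intros Hf Hg; apply Ccontinuous_pair; simpl.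
- apply (continuous_minus (V := R_NormedModule));
  apply (continuous_mult (K := R_AbsRing));
  first [now apply Ccontinuous_Re|now apply Ccontinuous_Im].
- apply (continuous_plus (V := R_NormedModule));
  apply (continuous_mult (K := R_AbsRing));
  first [now apply Ccontinuous_Re|now apply Ccontinuous_Im].
Qed.

Lemma Ccontinuous_RtoC (f : R -> R) (x : R) :
  continuous f x -> Ccontinuous (fun t => RtoC (f t)) x.
Proof.
intros H; apply Ccontinuous_pair; simpl; [exact H|apply continuous_const].
Qed.

Lemma Ccontinuous_Cmod (f : R -> C) (x : R) :
  Ccontinuous f x -> continuous (fun t => Cmod (f t)) x.
Proof.
intros H.
apply continuous_ext with (fun t => @norm R_AbsRing C_R_NormedModule (f t)).
{ intros t; apply norm_Cmod. }
apply (filterlim_comp _ _ _ f (@norm R_AbsRing C_R_NormedModule) _ (locally (f x))).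
- exact H.
- apply (@filterlim_norm R_AbsRing C_R_NormedModule).
Qed.

Lemma filterlim_Cmod {T : Type} (F : (T -> Prop) -> Prop) {FF : Filter F}
    (g : T -> C) (l : C) :
  (forall eps : posreal, F (fun x => Cmod (g x - l)%C < eps)) <->
  filterlim g F (@locally C_UniformSpace l).
Proof.
split; intros H.
- apply (proj2 (filterlim_locally_ball_norm (K := R_AbsRing) (U := C_R_NormedModule) g l)).
  intros eps; generalize (H eps); apply filter_imp; intros y Hy.
  unfold ball_norm; rewrite norm_Cmod; exact Hy.
- intros eps.
  generalize (proj1 (filterlim_locally_ball_norm (K := R_AbsRing) (U := C_R_NormedModule) g l) H eps).
  apply filter_imp; intros y Hy.
  unfold ball_norm in Hy; rewrite norm_Cmod in Hy; exact Hy.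
Qed.

Lemma Ccontinuous_eps (f : R -> C) (x : R) :
  (forall eps : posreal, locally x (fun y => Cmod (f y - f x)%C < eps)) <->
  Ccontinuous f x.
Proof. apply (filterlim_Cmod (locally x) f (f x)). Qed.

Lemma Cderive_pair (f : R -> C) (x : R) (l : C) :
  is_derive (fun t => Re (f t)) x (Re l) -> is_derive (fun t => Im (f t)) x (Im l) ->
  Cderive f x l.
Proof.
intros H1 H2.
destruct l as [l1 l2]; simpl in *.
apply is_derive_ext with (fun t => plus (scal (Re (f t)) ((1, 0) : C_R_NormedModule))
    (scal (Im (f t)) ((0, 1) : C_R_NormedModule))).
{ intros t; destruct (f t) as [u v]; unfold plus, scal; simpl; unfold prod_plus, prod_scal; simpl.
  unfold plus, scal; simpl; unfold mult; simpl; f_equal; ring. }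
replace ((l1, l2) : C) with (plus (scal l1 ((1, 0) : C_R_NormedModule))
    (scal l2 ((0, 1) : C_R_NormedModule))).
2:{ unfold plus, scal; simpl; unfold prod_plus, prod_scal; simpl.
  unfold plus, scal; simpl; unfold mult; simpl; f_equal; ring. }
apply (is_derive_plus (V := C_R_NormedModule)).
- apply (is_derive_scal_l (V := C_R_NormedModule)); exact H1.
- apply (is_derive_scal_l (V := C_R_NormedModule)); exact H2.
Qed.

Lemma Cderive_Re (f : R -> C) (x : R) (l : C) :
  Cderive f x l -> is_derive (fun t => Re (f t)) x (Re l).
Proof.
intros H.
apply (filterdiff_ext_lin _ (fun y : R => fst (@scal R_AbsRing C_R_NormedModule y l))).
- apply (filterdiff_comp' f fst); [exact H|].
  apply filterdiff_linear; apply is_linear_fst.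
- intros y; reflexivity.
Qed.

Lemma Cderive_Im (f : R -> C) (x : R) (l : C) :
  Cderive f x l -> is_derive (fun t => Im (f t)) x (Im l).
Proof.
intros H.
apply (filterdiff_ext_lin _ (fun y : R => snd (@scal R_AbsRing C_R_NormedModule y l))).
- apply (filterdiff_comp' f snd); [exact H|].
  apply filterdiff_linear; apply is_linear_snd.
- intros y; reflexivity.
Qed.

Lemma Cderive_mult (f g : R -> C) (x : R) (l m : C) :
  Cderive f x l -> Cderive g x m ->
  Cderive (fun t => (f t * g t)%C) x (l * g x + f x * m)%C.
Proof.
intros Hf Hg.
pose proof (Cderive_Re _ _ _ Hf) as F1; pose proof (Cderive_Im _ _ _ Hf) as F2.
pose proof (Cderive_Re _ _ _ Hg) as G1; pose proof (Cderive_Im _ _ _ Hg) as G2.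
apply Cderive_pair; simpl.
- evar_last.
  + apply (is_derive_minus (V := R_NormedModule)); apply (is_derive_mult (K := R_AbsRing));
    try (intros; apply Rmult_comm); eassumption.
  + unfold minus, plus, opp, mult; simpl; unfold Re, Im; ring.
- evar_last.
  + apply (is_derive_plus (V := R_NormedModule)); apply (is_derive_mult (K := R_AbsRing));
    try (intros; apply Rmult_comm); eassumption.
  + unfold minus, plus, opp, mult; simpl; unfold Re, Im; ring.
Qed.

Lemma Cderive_comp (f : R -> C) (g : R -> R) (x dg : R) (l : C) :
  Cderive f (g x) l -> is_derive g x dg ->
  Cderive (fun t => f (g t)) x (RtoC dg * l)%C.
Proof.
intros Hf Hg.
replace (RtoC dg * l)%C with (@scal R_AbsRing C_R_NormedModule dg l).
- apply (is_derive_comp f g); assumption.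
- destruct l; unfold scal; simpl; unfold prod_scal, scal; simpl; unfold mult; simpl.
  unfold Cmult; simpl; f_equal; ring.
Qed.

Lemma Cderive_RtoC (f : R -> R) (x l : R) :
  is_derive f x l -> Cderive (fun t => RtoC (f t)) x (RtoC l).
Proof.
intros H; apply Cderive_pair; simpl; [exact H|].
apply (is_derive_const (V := R_NormedModule)).
Qed.

Lemma Cderive_continuous (f : R -> C) (x : R) (l : C) :
  Cderive f x l -> Ccontinuous f x.
Proof.
intros H; apply (ex_derive_continuous (V := C_R_NormedModule)); now exists l.
Qed.

Lemma CisRInt_scal (f : R -> C) (a b : R) (k l : C) :
  CisRInt f a b l -> CisRInt (fun t => (k * f t)%C) a b (k * l)%C.
Proof.
intros H.
pose proof (is_RInt_fct_extend_fst f a b l H) as H1.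
pose proof (is_RInt_fct_extend_snd f a b l H) as H2.
apply (is_RInt_fct_extend_pair (fun t => (k * f t)%C) a b); simpl.
- apply (is_RInt_minus (V := R_NormedModule));
  apply (is_RInt_scal (V := R_NormedModule)); assumption.
- apply (is_RInt_plus (V := R_NormedModule));
  apply (is_RInt_scal (V := R_NormedModule)); assumption.
Qed.

Lemma CisRInt_CRInt (f : R -> C) (a b : R) :
  a <= b -> (forall x, a <= x <= b -> Ccontinuous f x) ->
  CisRInt f a b (CRInt f a b).
Proof.
intros Hab H; apply (@RInt_correct C_R_CompleteNormedModule).
apply (@ex_RInt_continuous C_R_CompleteNormedModule); intros x.
rewrite Rmin_left, Rmax_right by lra; apply H.
Qed.

Lemma CRInt_unique (f : R -> C) (a b : R) (l : C) :
  CisRInt f a b l -> CRInt f a b = l.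
Proof. apply (@is_RInt_unique C_R_CompleteNormedModule). Qed.

Lemma Cmod_RInt_le (f : R -> C) (g : R -> R) (a b : R) (l : C) (lg : R) :
  a <= b -> (forall x, a <= x <= b -> Cmod (f x) <= g x) ->
  CisRInt f a b l -> is_RInt g a b lg -> Cmod l <= lg.
Proof.
intros Hab H Hf Hg; rewrite <- norm_Cmod.
apply (norm_RInt_le (V := C_R_NormedModule) f g a b l lg); trivial.
intros x Hx; rewrite norm_Cmod; auto.
Qed.

Lemma Cmod_RInt_const (f : R -> C) (a b M : R) (l : C) :
  a <= b -> (forall x, a <= x <= b -> Cmod (f x) <= M) ->
  CisRInt f a b l -> Cmod l <= (b - a) * M.
Proof.
intros Hab H Hf; apply (Cmod_RInt_le f (fun _ => M) a b); trivial.
apply (is_RInt_const (V := R_NormedModule)).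
Qed.

Lemma CisRInt_derive (f df : R -> C) (a b : R) :
  a <= b -> (forall x, a <= x <= b -> Cderive f x (df x)) ->
  (forall x, a <= x <= b -> Ccontinuous df x) ->
  CisRInt df a b (f b - f a)%C.
Proof.
intros Hab H1 H2.
apply (is_RInt_derive (V := C_R_CompleteNormedModule));
  rewrite Rmin_left, Rmax_right by lra; assumption.
Qed.

Lemma CisRInt_plus (f g : R -> C) (a b : R) (l m : C) :
  CisRInt f a b l -> CisRInt g a b m -> CisRInt (fun t => (f t + g t)%C) a b (l + m)%C.
Proof. apply (is_RInt_plus (V := C_R_NormedModule)). Qed.

Lemma CisRInt_minus (f g : R -> C) (a b : R) (l m : C) :
  CisRInt f a b l -> CisRInt g a b m -> CisRInt (fun t => (f t - g t)%C) a b (l - m)%C.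
Proof. apply (is_RInt_minus (V := C_R_NormedModule)). Qed.

Lemma CisRInt_Chasles (f : R -> C) (a b c : R) (l m : C) :
  CisRInt f a b l -> CisRInt f b c m -> CisRInt f a c (l + m)%C.
Proof. apply (is_RInt_Chasles (V := C_R_NormedModule)). Qed.

Lemma CisRInt_ext (f g : R -> C) (a b : R) (l : C) :
  a <= b -> (forall x, a < x < b -> f x = g x) -> CisRInt f a b l -> CisRInt g a b l.
Proof.
intros Hab H; apply (is_RInt_ext (V := C_R_NormedModule)).
rewrite Rmin_left, Rmax_right by lra; assumption.
Qed.

(** * Complex powers *)

Lemma Cexp_plus (a b : C) : Cexp (a + b)%C = (Cexp a * Cexp b)%C.
Proof.
destruct a as [a1 a2], b as [b1 b2]; unfold Cexp, Cmult, Cplus, RtoC; simpl.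
rewrite exp_plus, cos_plus, sin_plus; f_equal; ring.
Qed.

Lemma Cmod_Cexp (a : C) : Cmod (Cexp a) = exp (Re a).
Proof.
unfold Cexp; rewrite Cmod_mult, Cmod_R, Rabs_pos_eq by (left; apply exp_pos).
replace (Cmod (cos (Im a), sin (Im a))) with 1; [ring|].
unfold Cmod; simpl fst; simpl snd.
rewrite <- !Rsqr_pow2, Rplus_comm, sin2_cos2, sqrt_1; reflexivity.
Qed.

Lemma Rpow_C_plus (t : R) (a b : C) : Rpow_C t (a + b)%C = (Rpow_C t a * Rpow_C t b)%C.
Proof. unfold Rpow_C; rewrite <- Cexp_plus; f_equal; ring. Qed.

Lemma Rpow_C_mult (t u : R) (a : C) :
  0 < t -> 0 < u -> Rpow_C (t * u) a = (Rpow_C t a * Rpow_C u a)%C.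
Proof.
intros Ht Hu; unfold Rpow_C; rewrite <- Cexp_plus, ln_mult, RtoC_plus by assumption.
f_equal; ring.
Qed.

Lemma Rpow_C_0 (t : R) : Rpow_C t (RtoC 0) = RtoC 1.
Proof.
unfold Rpow_C; rewrite Cmult_0_l; unfold Cexp, Cmult, RtoC; simpl.
rewrite exp_0, cos_0, sin_0; f_equal; ring.
Qed.

Lemma Rpow_C_1 (t : R) : 0 < t -> Rpow_C t (RtoC 1) = RtoC t.
Proof.
intros Ht; unfold Rpow_C; rewrite Cmult_1_l; unfold Cexp, Cmult, RtoC; simpl.
rewrite exp_ln, cos_0, sin_0 by assumption; f_equal; ring.
Qed.

Lemma Rpow_C_neq0 (t : R) (a : C) : Rpow_C t a <> RtoC 0.
Proof.
intros H; apply (f_equal Cmod) in H; unfold Rpow_C in H.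
rewrite Cmod_Cexp, Cmod_0 in H; generalize (exp_pos (Re (a * RtoC (ln t)))); lra.
Qed.

Lemma Rpow_C_opp (t : R) (a : C) : Rpow_C t (- a)%C = (/ Rpow_C t a)%C.
Proof.
assert (H : (Rpow_C t a * Rpow_C t (- a))%C = RtoC 1).
{ rewrite <- Rpow_C_plus, <- (Rpow_C_0 t); f_equal; ring. }
pose proof (Rpow_C_neq0 t a).
transitivity (/ Rpow_C t a * (Rpow_C t a * Rpow_C t (- a)))%C.
- field; assumption.
- rewrite H; ring.
Qed.

Lemma Rpow_C_div (t u : R) (a : C) :
  0 < t -> 0 < u -> Rpow_C (t / u) a = (Rpow_C t a / Rpow_C u a)%C.
Proof.
intros Ht Hu; pose proof (Rpow_C_neq0 u a).
assert (Htu : 0 < t / u) by (apply Rdiv_lt_0_compat; assumption).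
replace (Rpow_C t a) with (Rpow_C (t / u) a * Rpow_C u a)%C.
- field; assumption.
- rewrite <- Rpow_C_mult by assumption; f_equal; field; lra.
Qed.

Lemma Rpow_C_succ (t : R) (a : C) :
  0 < t -> Rpow_C t a = (RtoC t * Rpow_C t (a - RtoC 1))%C.
Proof.
intros Ht; rewrite <- (Rpow_C_1 t Ht); rewrite <- Rpow_C_plus; f_equal; ring.
Qed.

Lemma Cmod_Rpow_C (t : R) (a : C) : Cmod (Rpow_C t a) = Rpower t (Re a).
Proof.
unfold Rpow_C; rewrite Cmod_Cexp; unfold Rpower; f_equal.
destruct a; simpl; ring.
Qed.

Lemma Cderive_Rpow_C (t : R) (a : C) :
  0 < t -> Cderive (fun u => Rpow_C u a) t (a * Rpow_C t (a - RtoC 1))%C.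
Proof.
intros Ht.
assert (E : Rpow_C t (a - RtoC 1) = (RtoC (/ t) * Rpow_C t a)%C).
{ rewrite (Rpow_C_succ t a Ht), Cmult_assoc, <- RtoC_mult, Rinv_l by lra; ring. }
rewrite E; destruct a as [x y].
apply Cderive_pair; unfold Rpow_C, Cexp, Cmult, RtoC; simpl.
- auto_derive; [lra|]. unfold Rminus; field; lra.
- auto_derive; [lra|]. unfold Rminus; field; lra.
Qed.

Lemma Ccontinuous_Rpow_C (t : R) (a : C) :
  0 < t -> Ccontinuous (fun u => Rpow_C u a) t.
Proof.
intros Ht; eapply Cderive_continuous; apply Cderive_Rpow_C; assumption.
Qed.

Lemma is_derive_Rpower (t a : R) :
  0 < t -> is_derive (fun u => Rpower u a) t (a * Rpower t (a - 1)).
Proof.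
intros Ht; unfold Rpower; auto_derive; [assumption|].
replace ((a - 1) * ln t) with (a * ln t + - ln t) by ring.
rewrite exp_plus, exp_Ropp, exp_ln by assumption; field; lra.
Qed.

Lemma is_RInt_Rpower (u v a : R) :
  0 < u <= v -> a <> 0 ->
  is_RInt (fun t => Rpower t (a - 1)) u v ((Rpower v a - Rpower u a) / a).
Proof.
intros Huv Ha.
replace ((Rpower v a - Rpower u a) / a) with
  (minus ((fun t => Rpower t a / a) v) ((fun t => Rpower t a / a) u))
  by (unfold minus, plus, opp; simpl; field; assumption).
apply (is_RInt_derive (V := R_CompleteNormedModule) (fun t => Rpower t a / a));
  intros x; rewrite Rmin_left, Rmax_right by lra; intros Hx.
- evar_last.
  + apply (is_derive_scal_l (V := R_NormedModule) (fun t => Rpower t a) x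
      (a * Rpower x (a - 1)) (/ a)), is_derive_Rpower; lra.
  + unfold scal; simpl; unfold mult; simpl; field; assumption.
- apply (ex_derive_continuous (V := R_NormedModule)).
  eexists; apply is_derive_Rpower; lra.
Qed.

Lemma Rpower_le_1 (t a : R) : 0 < t <= 1 -> 0 <= a -> Rpower t a <= 1.
Proof.
intros Ht Ha; unfold Rpower; rewrite <- exp_0.
assert (ln t <= 0) by (rewrite <- ln_1; apply ln_le; lra).
assert (a * ln t <= 0) by nra.
destruct (Req_dec (a * ln t) 0) as [->|]; [lra|left; apply exp_increasing; lra].
Qed.

Lemma Rpower_antitone (t a b : R) : 0 < t <= 1 -> a <= b -> Rpower t b <= Rpower t a.
Proof.
intros Ht Hab; replace b with ((b - a) + a) by ring; rewrite Rpower_plus.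
rewrite <- (Rmult_1_l (Rpower t a)) at 2.
apply Rmult_le_compat_r; [left; apply exp_pos|apply Rpower_le_1; lra].
Qed.

Lemma Rpower_pos (t a : R) : 0 < Rpower t a.
Proof. apply exp_pos. Qed.

Lemma Rpower_le_inv (t a : R) : 0 < t <= 1 -> -1 <= a -> Rpower t a <= / t.
Proof.
intros Ht Ha.
replace (/ t) with (Rpower t (Ropp 1)) by (rewrite Rpower_Ropp, Rpower_1; lra).
apply Rpower_antitone; lra.
Qed.

(** * Limits of integrals and integrals with a parameter *)

Lemma locally_Cmod (l : C) (P : C -> Prop) :
  @locally C_UniformSpace l P <->
  exists eps : posreal, forall y, Cmod (y - l)%C < eps -> P y.
Proof.
split; intros H.
- apply (@locally_norm_le_locally R_AbsRing C_R_NormedModule) in H.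
  destruct H as [eps H]; exists eps; intros y Hy; apply H.
  unfold ball_norm; rewrite norm_Cmod; exact Hy.
- apply (@locally_le_locally_norm R_AbsRing C_R_NormedModule).
  destruct H as [eps H]; exists eps; intros y Hy; apply H.
  unfold ball_norm in Hy; rewrite norm_Cmod in Hy; exact Hy.
Qed.

Lemma Cderive_eps (f : R -> C) (x : R) (l : C) :
  (forall eps : posreal,
     locally x (fun y => Cmod (f y - f x - RtoC (y - x) * l)%C <= eps * Rabs (y - x))) ->
  Cderive f x l.
Proof.
intros H; split; [apply is_linear_scal_l|].
intros x0 Hx0 eps.
rewrite <- (is_filter_lim_locally_unique _ _ Hx0).
generalize (H eps); apply filter_imp; intros y Hy.
rewrite norm_Cmod.
eapply Rle_trans; [|exact Hy]; right; f_equal.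
unfold minus, plus, opp, scal; simpl; unfold prod_plus, prod_opp, prod_scal; simpl.
unfold plus, opp, scal; simpl; unfold mult; simpl.
unfold Cminus, Cplus, Copp, Cmult, RtoC; simpl; f_equal; ring.
Qed.

Lemma Rpower_lt_eps (sigma K : R) (eps : posreal) :
  0 < sigma -> 0 <= K ->
  exists delta : posreal, forall u, 0 < u < delta -> K * Rpower u sigma < eps.
Proof.
intros Hs HK.
assert (HK1 : 0 < eps / (K + 1)).
{ apply Rdiv_lt_0_compat; [apply eps|lra]. }
(* The radius solves [(K + 1) delta^sigma = eps]; using [K + 1] keeps the quotient meaningful when
   [K = 0]. *)
exists (mkposreal _ (Rpower_pos (eps / (K + 1)) (/ sigma))); simpl; intros u [Hu0 Hu].
assert (H : Rpower u sigma < eps / (K + 1)).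
{ replace (eps / (K + 1)) with (Rpower (Rpower (eps / (K + 1)) (/ sigma)) sigma).
  - apply Rlt_Rpower_l; lra.
  - rewrite Rpower_mult, Rinv_l, Rpower_1; lra. }
apply Rle_lt_trans with (K * (eps / (K + 1))).
- apply Rmult_le_compat_l; lra.
- apply Rlt_le_trans with ((K + 1) * (eps / (K + 1))).
  + apply Rmult_lt_compat_r; lra.
  + right; field; lra.
Qed.

Lemma at_right_0_lt (d : R) : 0 < d -> at_right 0 (fun u => 0 < u < d).
Proof.
intros Hd; exists (mkposreal d Hd); intros u Hu Hu0; simpl in Hu.
unfold ball in Hu; simpl in Hu; unfold AbsRing_ball, abs, minus, plus, opp in Hu; simpl in Hu.
apply Rabs_def2 in Hu; lra.
Qed.

Lemma at_left_1_lt (d : R) : 0 < d -> at_left 1 (fun v => 1 - d < v < 1).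
Proof.
intros Hd; exists (mkposreal d Hd); intros u Hu Hu0; simpl in Hu.
unfold ball in Hu; simpl in Hu; unfold AbsRing_ball, abs, minus, plus, opp in Hu; simpl in Hu.
apply Rabs_def2 in Hu; lra.
Qed.

(** Cauchy criterion at 0: the hypothesis bounds the oscillation of [g] on [(0, v]], and letting the
    inner point tend to 0 preserves the constant. *)
Lemma limit_at_right_rate (g : R -> C) (r K sigma : R) :
  0 < r -> 0 < sigma ->
  (forall u v, 0 < u < v -> v <= r -> Cmod (g v - g u)%C <= K * Rpower v sigma) ->
  exists l : C, forall u, 0 < u <= r -> Cmod (g u - l)%C <= K * Rpower u sigma.
Proof.
intros Hr Hs H.
assert (HK : 0 <= K).
{ assert (H1 := H (r / 2) r ltac:(lra) ltac:(lra)).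
  assert (H2 := Cmod_ge_0 (g r - g (r / 2)%R)%C); assert (H3 := Rpower_pos r sigma).
  destruct (Rle_or_lt 0 K); [trivial|nra]. }
assert (Hsym : forall u v, 0 < u <= r -> 0 < v <= r ->
   Cmod (g v - g u)%C <= K * Rpower (Rmax u v) sigma).
{ intros u v Hu Hv; destruct (Rtotal_order u v) as [Huv|[<-|Huv]].
  - rewrite Rmax_right by lra; apply H; lra.
  - replace (g u - g u)%C with (RtoC 0) by ring; rewrite Cmod_0.
    apply Rmult_le_pos; [trivial|left; apply Rpower_pos].
  - rewrite Rmax_left by lra; rewrite <- Cmod_opp.
    replace (- (g v - g u))%C with (g u - g v)%C by ring; apply H; lra. }
destruct (proj1 (filterlim_locally_cauchy (U := C_R_CompleteNormedModule) (F := at_right 0) g))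
  as [l Hl].
{ intros eps; destruct (Rpower_lt_eps sigma K eps Hs HK) as [d Hd].
  exists (fun u => 0 < u < Rmin d r); split.
  - apply at_right_0_lt, Rmin_pos; [apply d|trivial].
  - intros u v Hu Hv; apply (@norm_compat1 R_AbsRing C_R_NormedModule); rewrite norm_Cmod.
    pose proof (Rmin_l d r); pose proof (Rmin_r d r).
    eapply Rle_lt_trans; [apply (Hsym u v); lra|].
    apply Hd; split; [apply Rlt_le_trans with u; [lra|apply Rmax_l]|apply Rmax_lub_lt; lra]. }
exists l; intros u Hu; apply le_epsilon; intros eps Heps.
assert (H1 := proj2 (filterlim_Cmod (at_right 0) g l) Hl (mkposreal eps Heps)).
assert (H2 := at_right_0_lt u ltac:(lra)).
destruct (filter_ex _ (filter_and _ _ H1 H2)) as [v [Hv1 Hv2]]; simpl in Hv1.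
replace (g u - l)%C with ((g u - g v) + (g v - l))%C by ring.
eapply Rle_trans; [apply Cmod_triangle|].
assert (H3 := H v u ltac:(lra) ltac:(lra)); lra.
Qed.

Lemma is_RInt_gen_Cmod (F G : (R -> Prop) -> Prop) {FF : Filter F} {FG : Filter G}
    (f : R -> C) (l : C) :
  (forall eps : posreal, filter_prod F G (fun ab => exists y,
     CisRInt f (fst ab) (snd ab) y /\ Cmod (y - l)%C < eps)) <->
  @is_RInt_gen C_R_NormedModule f F G l.
Proof.
split; intros H.
- intros P HP; apply locally_Cmod in HP; destruct HP as [eps HP].
  refine (@filter_imp _ (filter_prod F G) _ _ _ _ (H eps)); intros ab [y [Hy1 Hy2]].
  exists y; split; [exact Hy1|apply HP; exact Hy2].
- intros eps; apply (H (fun y => Cmod (y - l)%C < eps)).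
  apply locally_Cmod; exists eps; trivial.
Qed.

Lemma CInt_01_rate (f : R -> C) (K sigma : R) :
  0 < sigma ->
  (forall t, 0 < t < 1 -> Ccontinuous f t) ->
  (forall u v l, 0 < u < v -> v <= / 4 -> CisRInt f u v l -> Cmod l <= K * Rpower v sigma) ->
  (forall u v l, 0 < u < v -> v <= / 4 -> CisRInt f (1 - v) (1 - u) l ->
     Cmod l <= K * Rpower v sigma) ->
  exists l, @is_RInt_gen C_R_NormedModule f (at_right 0) (at_left 1) l /\
    forall u, 0 < u <= / 4 -> Cmod (CRInt f u (1 - u) - l)%C <= 2 * K * Rpower u sigma.
Proof.
intros Hs Hc H0 H1.
assert (I : forall a b, 0 < a <= b -> b < 1 -> CisRInt f a b (CRInt f a b)).
{ intros a b Ha Hb; apply CisRInt_CRInt; [lra|]; intros x Hx; apply Hc; lra. }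
assert (Ch : forall a b c, 0 < a <= b -> b <= c -> c < 1 ->
   CRInt f a c = (CRInt f a b + CRInt f b c)%C).
{ intros a b c Ha Hb Hcc; apply CRInt_unique.
  apply CisRInt_Chasles with b; apply I; lra. }
destruct (limit_at_right_rate (fun u => CRInt f u (/ 2)) (/ 4) K sigma) as [l0 Hl0];
  [lra|assumption| |].
{ intros u v Hu Hv.
  rewrite (Ch u v (/ 2)) by lra.
  replace (CRInt f v (/ 2) - (CRInt f u v + CRInt f v (/ 2)))%C with (- CRInt f u v)%C by ring.
  rewrite Cmod_opp; apply (H0 u v); try lra; apply I; lra. }
destruct (limit_at_right_rate (fun u => CRInt f (/ 2) (1 - u)) (/ 4) K sigma) as [l1 Hl1];
  [lra|assumption| |].
{ intros u v Hu Hv.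
  rewrite (Ch (/ 2) (1 - v) (1 - u)) by lra.
  replace (CRInt f (/ 2) (1 - v) - (CRInt f (/ 2) (1 - v) + CRInt f (1 - v) (1 - u)))%C
    with (- CRInt f (1 - v) (1 - u))%C by ring.
  rewrite Cmod_opp; apply (H1 u v); try lra; apply I; lra. }
assert (B : forall u v, 0 < u <= / 4 -> 0 < v <= / 4 ->
  Cmod (CRInt f u (1 - v) - (l0 + l1))%C <= K * Rpower u sigma + K * Rpower v sigma).
{ intros u v Hu Hv; rewrite (Ch u (/ 2) (1 - v)) by lra.
  replace (CRInt f u (/ 2) + CRInt f (/ 2) (1 - v) - (l0 + l1))%C with
    ((CRInt f u (/ 2) - l0) + (CRInt f (/ 2) (1 - v) - l1))%C by ring.
  eapply Rle_trans; [apply Cmod_triangle|].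
  apply Rplus_le_compat; [apply Hl0|apply Hl1]; lra. }
assert (HK : 0 <= K).
{ assert (E := H0 (/ 8) (/ 4) _ ltac:(lra) ltac:(lra) (I (/ 8) (/ 4) ltac:(lra) ltac:(lra))).
  assert (E1 := Cmod_ge_0 (CRInt f (/ 8) (/ 4))); assert (E2 := Rpower_pos (/ 4) sigma).
  destruct (Rle_or_lt 0 K); [trivial|nra]. }
exists (l0 + l1)%C; split.
- apply is_RInt_gen_Cmod; try typeclasses eauto.
  intros eps; destruct (Rpower_lt_eps sigma (2 * K) eps Hs ltac:(lra)) as [d Hd].
  assert (Hm : 0 < Rmin d (/ 4)) by (apply Rmin_pos; [apply d|lra]).
  pose proof (Rmin_l d (/ 4)); pose proof (Rmin_r d (/ 4)).
  apply (Filter_prod _ _ _ _ _ (at_right_0_lt _ Hm) (at_left_1_lt _ Hm)).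
  intros u v Hu Hv; simpl; exists (CRInt f u v); split; [apply I; lra|].
  replace v with (1 - (1 - v)) by ring.
  eapply Rle_lt_trans; [apply B; lra|].
  assert (E1 := Hd u ltac:(lra)); assert (E2 := Hd (1 - v) ltac:(lra)); lra.
- intros u Hu; eapply Rle_trans; [apply B; lra|right; ring].
Qed.

Lemma CisRInt_uniform_limit (f : nat -> R -> C) (h : nat -> C) (g : R -> C) (a b : R) :
  a <= b -> (forall n, CisRInt (f n) a b (h n)) ->
  (forall eps : posreal, eventually (fun n => forall x, a <= x <= b ->
     Cmod (f n x - g x)%C < eps)) ->
  exists l, filterlim h eventually (@locally C_UniformSpace l) /\ CisRInt g a b l.
Proof.
intros Hab Hf Hu.
(* [filterlim_RInt] asks for uniform convergence on the whole line, so everything is extended by 0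
   outside [[a, b]]. *)
pose (cut := fun (k : R -> C) (x : R) =>
  if Rle_dec a x then if Rle_dec x b then k x else RtoC 0 else RtoC 0).
assert (Hcut : forall k x, a <= x <= b -> cut k x = k x).
{ intros k x Hx; unfold cut; destruct (Rle_dec a x), (Rle_dec x b); trivial; lra. }
destruct (filterlim_RInt (V := C_R_CompleteNormedModule) (fun n => cut (f n)) a b eventually _
  (cut g) h) as [l [Hl1 Hl2]].
- intros n; apply CisRInt_ext with (f n); [trivial| |apply Hf].
  intros x Hx; rewrite Hcut by lra; reflexivity.
- apply filterlim_locally; intros eps.
  generalize (Hu eps); apply filter_imp; intros n Hn x.
  apply (@norm_compat1 R_AbsRing C_R_NormedModule); rewrite norm_Cmod.
  unfold cut; destruct (Rle_dec a x); [destruct (Rle_dec x b)|].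
  + apply Hn; lra.
  + replace (minus _ _) with (RtoC 0 - RtoC 0)%C by reflexivity.
    replace (RtoC 0 - RtoC 0)%C with (RtoC 0) by ring; rewrite Cmod_0; apply eps.
  + replace (minus _ _) with (RtoC 0 - RtoC 0)%C by reflexivity.
    replace (RtoC 0 - RtoC 0)%C with (RtoC 0) by ring; rewrite Cmod_0; apply eps.
- exists l; split; [exact Hl1|].
  apply CisRInt_ext with (cut g); [trivial| |exact Hl2].
  intros x Hx; apply Hcut; lra.
Qed.

Lemma Cmod_increment_le (h dh : R -> C) (x y M : R) :
  (forall r, Rmin x y <= r <= Rmax x y -> Cderive h r (dh r)) ->
  (forall r, Rmin x y <= r <= Rmax x y -> Ccontinuous dh r) ->
  (forall r, Rmin x y <= r <= Rmax x y -> Cmod (dh r) <= M) ->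
  Cmod (h y - h x)%C <= M * Rabs (y - x).
Proof.
intros H1 H2 H3; destruct (Rle_or_lt x y) as [Hxy|Hxy].
- rewrite Rmin_left, Rmax_right in * by lra.
  rewrite Rabs_pos_eq, Rmult_comm by lra.
  apply (Cmod_RInt_const dh x y); trivial; apply CisRInt_derive; trivial.
- rewrite Rmin_right, Rmax_left in * by lra.
  rewrite Rabs_minus_sym, Rabs_pos_eq, Rmult_comm by lra.
  rewrite <- Cmod_opp; replace (- (h y - h x))%C with (h x - h y)%C by ring.
  apply (Cmod_RInt_const dh y x); [lra|trivial|apply CisRInt_derive; trivial; lra].
Qed.

(* Differentiation under the integral sign and the fundamental theorem replace Fubini. *)
Lemma CisRInt_param (f F : R -> R -> C) (c d : R) :
  c < d ->
  (forall r t, 0 < r -> c <= t <= d -> Cderive (fun r' => F r' t) r (f r t)) ->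
  (forall r (eps : posreal), 0 < r ->
     locally r (fun r' => forall t, c <= t <= d -> Cmod (f r' t - f r t)%C <= eps)) ->
  (forall r t, 0 < r -> c <= t <= d -> Ccontinuous (f r) t) ->
  (forall r t, 0 < r -> c <= t <= d -> Ccontinuous (F r) t) ->
  forall a b, 0 < a <= b ->
  CisRInt (fun r => CRInt (f r) c d) a b (CRInt (F b) c d - CRInt (F a) c d)%C.
Proof.
intros Hcd HD HU Hf HF a b Hab.
assert (Hfr : forall r t, 0 < r -> c <= t <= d -> Ccontinuous (fun r' => f r' t) r).
{ intros r t Hr Ht; apply Ccontinuous_eps; intros eps.
  generalize (HU r (pos_div_2 eps) Hr); apply filter_imp; intros r' H.
  specialize (H t Ht); simpl in H; generalize (cond_pos eps); lra. }
assert (If : forall r, 0 < r -> CisRInt (f r) c d (CRInt (f r) c d)).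
{ intros r Hr; apply CisRInt_CRInt; [lra|]; intros x Hx; apply Hf; trivial. }
assert (IF : forall r, 0 < r -> CisRInt (F r) c d (CRInt (F r) c d)).
{ intros r Hr; apply CisRInt_CRInt; [lra|]; intros x Hx; apply HF; trivial. }
assert (Hpos : forall r, 0 < r -> locally r (fun r' => 0 < r')).
{ intros r Hr; apply (open_gt 0 r Hr). }
assert (Hdc : forall eps : posreal, 0 < eps / (2 * (d - c))).
{ intros eps; apply Rdiv_lt_0_compat; [apply eps|lra]. }
apply (CisRInt_derive (fun r => CRInt (F r) c d)); [lra| |]; intros r Hr.
- apply Cderive_eps; intros eps.
  assert (HU' := HU r (mkposreal _ (Hdc eps)) ltac:(lra)).
  destruct (filter_and _ _ HU' (Hpos r ltac:(lra))) as [del Hdel]; simpl in Hdel.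
  exists del; intros r' Hr'.
  assert (Hin : forall x, Rmin r r' <= x <= Rmax r r' -> ball r del x).
  { intros x Hx; revert Hr'.
    unfold ball; simpl; unfold AbsRing_ball, abs, minus, plus, opp; simpl.
    intros Hr'; apply Rabs_def2 in Hr'; apply Rabs_def1;
    unfold Rmin, Rmax in Hx; destruct (Rle_dec r r'); lra. }
  assert (Hr'0 : 0 < r') by (apply Hdel; exact Hr').
  assert (Hm := CisRInt_minus _ _ _ _ _ _
    (CisRInt_minus _ _ _ _ _ _ (IF r' Hr'0) (IF r ltac:(lra)))
    (CisRInt_scal _ _ _ (RtoC (r' - r)) _ (If r ltac:(lra)))).
  eapply Rle_trans; [eapply (Cmod_RInt_const _ c d
    (eps / (2 * (d - c)) * Rabs (r' - r))); [lra| |exact Hm]|].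
  + intros t Ht; simpl.
    (* The remainder is the increment from [r] to [r'] of [F x t - (x - r) f r t] as a function of
       [x]. Its derivative [f x t - f r t] is small uniformly in [t], so the mean value inequality
       applies. *)
    replace (F r' t - F r t - RtoC (r' - r) * f r t)%C with
      ((F r' t - RtoC (r' - r) * f r t) - (F r t - RtoC (r - r) * f r t))%C
      by (replace (r - r) with 0 by ring; ring).
    apply (Cmod_increment_le (fun x => F x t - RtoC (x - r) * f r t)%C
      (fun x => f x t - f r t)%C); intros x Hx.
    * assert (Hx0 : 0 < x) by (apply Hdel, Hin; exact Hx).
      apply (is_derive_minus (V := C_R_NormedModule)); [apply HD; trivial|].
      evar_last.
      { apply Cderive_mult; [|apply (is_derive_const (V := C_R_NormedModule))].
        apply (Cderive_RtoC (fun y => y - r) x 1); auto_derive; [trivial|reflexivity]. }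
      transitivity (RtoC 1 * f r t + RtoC (x - r) * RtoC 0)%C; [reflexivity|ring].
    * apply (continuous_minus (V := C_R_NormedModule)); [|apply continuous_const].
      apply Hfr; [apply Hdel, Hin; exact Hx|trivial].
    * apply Hdel; [apply Hin; exact Hx|trivial].
  + apply Rle_trans with (eps / 2 * Rabs (r' - r)).
    * right; field; lra.
    * apply Rmult_le_compat_r; [apply Rabs_pos|generalize (cond_pos eps); lra].
- apply Ccontinuous_eps; intros eps.
  assert (HU' := HU r (mkposreal _ (Hdc eps)) ltac:(lra)).
  generalize (filter_and _ _ HU' (Hpos r ltac:(lra))); apply filter_imp.
  intros r' [H1 H2]; simpl in H1.
  assert (Hm := CisRInt_minus _ _ _ _ _ _ (If r' H2) (If r ltac:(lra))).
  eapply Rle_lt_trans; [apply (Cmod_RInt_const _ c d (eps / (2 * (d - c)))) in Hm;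
    [exact Hm|lra|exact H1]|].
  apply Rle_lt_trans with (eps / 2); [right; field; lra|generalize (cond_pos eps); lra].
Qed.

(** * Series and the primitive of the kernel *)

Lemma is_Cseries_pair (a : nat -> C) (l : C) :
  @is_series C_AbsRing C_NormedModule a l <->
  is_series (fun n => Re (a n)) (Re l) /\ is_series (fun n => Im (a n)) (Im l).
Proof.
assert (E : forall n, @sum_n C_AbelianGroup a n =
   (sum_n (fun k => Re (a k)) n, sum_n (fun k => Im (a k)) n)).
{ intros n; induction n as [|n IH].
  - rewrite !sum_O; destruct (a O); reflexivity.
  - rewrite !sum_Sn, IH; reflexivity. }
split.
- intros H; split.
  + apply filterlim_ext with (fun n => fst (@sum_n C_AbelianGroup a n)).
    { intros n; rewrite E; reflexivity. }
    apply (filterlim_comp _ _ _ (@sum_n C_AbelianGroup a) fst eventually (@locally C_UniformSpace l));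
      [exact H|apply (continuous_fst (U := R_UniformSpace) (V := R_UniformSpace) (fst l) (snd l))].
  + apply filterlim_ext with (fun n => snd (@sum_n C_AbelianGroup a n)).
    { intros n; rewrite E; reflexivity. }
    apply (filterlim_comp _ _ _ (@sum_n C_AbelianGroup a) snd eventually (@locally C_UniformSpace l));
      [exact H|apply (continuous_snd (U := R_UniformSpace) (V := R_UniformSpace) (fst l) (snd l))].
- intros [H1 H2] P [eps HP].
  assert (H1' := H1 _ (locally_ball (Re l) eps)); assert (H2' := H2 _ (locally_ball (Im l) eps)).
  destruct H1' as [N1 H1'], H2' as [N2 H2'].
  exists (Nat.max N1 N2); intros n Hn; apply HP.
  change (@sum_n (NormedModule.AbelianGroup C_AbsRing C_NormedModule) a n)
    with (@sum_n C_AbelianGroup a n).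
  rewrite E; split; [apply H1'|apply H2']; lia.
Qed.

Lemma CSeries_pair (a : nat -> C) :
  ex_CSeries a ->
  ex_series (fun n => Re (a n)) /\ ex_series (fun n => Im (a n)) /\
  CSeries a = (Series (fun n => Re (a n)), Series (fun n => Im (a n))).
Proof.
intros [l Hl]; rewrite (CSeries_unique a l Hl).
apply is_Cseries_pair in Hl; destruct Hl as [H1 H2].
split; [|split].
- now exists (Re l).
- now exists (Im l).
- rewrite (is_series_unique _ _ H1), (is_series_unique _ _ H2); destruct l; reflexivity.
Qed.

(** With a finite radius the terms would fail to tend to 0 at a negative point beyond it. *)
Lemma CV_radius_infinite_neg (a : nat -> R) :
  (forall t, 0 < t -> ex_series (fun n => a n * (- t) ^ n)) -> CV_radius a = p_infty.
Proof.
intros H; destruct (CV_radius a) as [r| |] eqn:E; trivial; exfalso.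
- assert (Hr : 0 < Rabs r + 1) by (generalize (Rabs_pos r); lra).
  apply (CV_disk_outside a (- (Rabs r + 1))).
  + rewrite E; simpl; rewrite Rabs_Ropp, Rabs_pos_eq by lra.
    generalize (Rle_abs r); lra.
  + apply ex_series_lim_0, H; assumption.
- generalize (CV_radius_ge_0 a); rewrite E; simpl; tauto.
Qed.

Lemma Cpow_RtoC (t : R) (n : nat) : Cpow (RtoC t) n = RtoC (t ^ n).
Proof. symmetry; apply RtoC_pow. Qed.

(** Carries convergence from the negative half-line, where the M-gamma hypothesis gives it, to all
    real [t], and adds continuity, including at 0. Since [t] is real, the real and imaginary parts
    are power series with real coefficients. *)
Lemma entire_series_neg (a : nat -> C) :
  (forall t, 0 < t -> ex_CSeries (fun n => a n * Cpow (RtoC (- t)) n)%C) ->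
  forall t, ex_CSeries (fun n => a n * Cpow (RtoC t) n)%C /\
    Ccontinuous (fun t => CSeries (fun n => a n * Cpow (RtoC t) n)%C) t.
Proof.
intros H.
assert (ERe : forall t n, Re (a n * Cpow (RtoC t) n)%C = Re (a n) * t ^ n).
{ intros t n; rewrite Cpow_RtoC; destruct (a n); simpl; ring. }
assert (EIm : forall t n, Im (a n * Cpow (RtoC t) n)%C = Im (a n) * t ^ n).
{ intros t n; rewrite Cpow_RtoC; destruct (a n); simpl; ring. }
assert (R1 : CV_radius (fun n => Re (a n)) = p_infty).
{ apply CV_radius_infinite_neg; intros t Ht.
  destruct (CSeries_pair _ (H t Ht)) as [H1 _].
  apply ex_series_ext with (2 := H1); intros n; apply ERe. }
assert (R2 : CV_radius (fun n => Im (a n)) = p_infty).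
{ apply CV_radius_infinite_neg; intros t Ht.
  destruct (CSeries_pair _ (H t Ht)) as [_ [H1 _]].
  apply ex_series_ext with (2 := H1); intros n; apply EIm. }
assert (S : forall t, is_series (fun n => Re (a n * Cpow (RtoC t) n)%C)
                        (PSeries (fun n => Re (a n)) t) /\
                      is_series (fun n => Im (a n * Cpow (RtoC t) n)%C)
                        (PSeries (fun n => Im (a n)) t)).
{ intros t; split.
  - apply is_series_ext with (fun n => Re (a n) * t ^ n);
      [intros n; symmetry; apply ERe|].
    apply is_pseries_R, PSeries_correct, CV_radius_inside; rewrite R1; exact I.
  - apply is_series_ext with (fun n => Im (a n) * t ^ n);
      [intros n; symmetry; apply EIm|].
    apply is_pseries_R, PSeries_correct, CV_radius_inside; rewrite R2; exact I. }
assert (S' : forall t, @is_series C_AbsRing C_NormedModule (fun n => a n * Cpow (RtoC t) n)%C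
   (PSeries (fun n => Re (a n)) t, PSeries (fun n => Im (a n)) t)).
{ intros t; apply is_Cseries_pair; apply S. }
intros t; split; [eexists; apply S'|].
apply (continuous_ext (T := R_UniformSpace) (U := C_UniformSpace)
  (fun t => (PSeries (fun n => Re (a n)) t, PSeries (fun n => Im (a n)) t) : C)).
{ intros u; symmetry; apply CSeries_unique, S'. }
apply Ccontinuous_pair; simpl; apply continuity_pt_filterlim, PSeries_continuity.
- rewrite R1; exact I.
- rewrite R2; exact I.
Qed.

Lemma Ccontinuous_bounded (f : R -> C) (a b : R) :
  a <= b -> (forall x, a <= x <= b -> Ccontinuous f x) ->
  exists M, 0 <= M /\ forall x, a <= x <= b -> Cmod (f x) <= M.
Proof.
intros Hab H.
destruct (continuity_ab_maj (fun x => Cmod (f x)) a b Hab) as [m [Hm _]].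
- intros x Hx; apply continuity_pt_filterlim, Ccontinuous_Cmod, H, Hx.
- exists (Cmod (f m)); split; [apply Cmod_ge_0|exact Hm].
Qed.

Lemma Rpower_ge_1 (t a : R) : 1 <= t -> 0 <= a -> 1 <= Rpower t a.
Proof.
intros Ht Ha; rewrite <- (Rpower_O t) by lra; apply Rle_Rpower; lra.
Qed.

(** One constant [K] serves two purposes: the uniform bound feeds the integration by parts in [t],
    and the power bound makes the lower end of the Mellin integral vanish. The last clause
    identifies the limit at the upper end. *)
Definition is_primitive_of_kernel (psi : R -> C) (sigma : R) (L : C) (G : R -> C) (K : R) : Prop :=
  (forall v, 0 < v -> Cderive G v (psi v)) /\
  (forall v, 0 < v -> Cmod (G v) <= K) /\
  (forall v, 0 < v -> Cmod (G v) <= K * Rpower v sigma) /\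
  (forall eps, 0 < eps -> exists V, 0 < V /\ forall v, V <= v -> Cmod (G v - L)%C <= eps).

(* [G v] is the integral of the kernel over [(0, v)]; convergence at infinity is
   only conditional, and boundedness of [G] is all that remains of it. *)
Lemma primitive_exists (phi : R -> C) (s L : C) :
  0 < Re s -> (forall t, Ccontinuous phi t) ->
  is_CInt_0oo (fun t => Rpow_C t (s - RtoC 1) * phi t)%C L ->
  exists G K, is_primitive_of_kernel (fun t => Rpow_C t (s - RtoC 1) * phi t)%C (Re s) L G K.
Proof.
intros Hs Hphi HL.
set (psi := fun t => (Rpow_C t (s - RtoC 1) * phi t)%C) in *.
assert (Hpsi : forall t, 0 < t -> Ccontinuous psi t).
{ intros t Ht; apply Ccontinuous_mult; [apply Ccontinuous_Rpow_C; trivial|apply Hphi]. }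
assert (I : forall a b, 0 < a -> 0 < b -> CisRInt psi a b (CRInt psi a b)).
{ intros a b Ha Hb; apply (@RInt_correct C_R_CompleteNormedModule).
  apply (@ex_RInt_continuous C_R_CompleteNormedModule); intros x Hx; apply Hpsi.
  unfold Rmin, Rmax in Hx; destruct (Rle_dec a b); lra. }
(* The base point 1 keeps away from both improper ends. Subtracting the limit [l] of [P] at 0 later
   moves the base point to 0. *)
set (P := fun v => CRInt psi 1 v).
assert (HP : forall a b, 0 < a -> 0 < b -> CRInt psi a b = (P b - P a)%C).
{ intros a b Ha Hb.
  assert (E : P b = (P a + CRInt psi a b)%C).
  { apply CRInt_unique; apply CisRInt_Chasles with a; apply I; lra. }
  rewrite E; assert (A : forall x y : C, x = (y + x - y)%C) by (intros; ring); apply A. }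
(* Near 0 the kernel is at most [M t^(Re s - 1)], whose integral over [(0, v)] is
   [(M / Re s) v^(Re s)]. *)
destruct (Ccontinuous_bounded phi 0 1) as [M [HM0 HM]]; [lra|intros; apply Hphi|].
assert (HM1 : 0 <= M / Re s) by (apply Rmult_le_pos; [trivial|left; apply Rinv_0_lt_compat; trivial]).
destruct (limit_at_right_rate P 1 (M / Re s) (Re s)) as [l Hl]; [lra|trivial| |].
{ intros u v Hu Hv; rewrite <- HP by lra.
  eapply Rle_trans.
  - apply (Cmod_RInt_le psi (fun t => scal M (Rpower t (Re s - 1))) u v); [lra| | |].
    + intros x Hx; unfold psi; rewrite Cmod_mult, Cmod_Rpow_C, Rmult_comm.
      replace (Re (s - RtoC 1)%C) with (Re s - 1) by (destruct s; simpl; ring).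
      apply Rmult_le_compat_r; [left; apply Rpower_pos|apply HM; lra].
    + apply I; lra.
    + apply (is_RInt_scal (V := R_NormedModule)), is_RInt_Rpower; lra.
  - unfold scal; simpl; unfold mult; simpl.
    assert (0 < Rpower u (Re s)) by apply Rpower_pos.
    unfold Rdiv; rewrite <- !Rmult_assoc, (Rmult_comm _ (/ Re s)), <- !Rmult_assoc.
    rewrite (Rmult_comm (/ Re s) M).
    apply Rmult_le_compat_l; [trivial|lra]. }
assert (Hinf : forall eps, 0 < eps ->
   exists V, 0 < V /\ forall v, V <= v -> Cmod (P v - l - L)%C <= eps).
{ intros eps Heps.
  (* The two-ended limit is decoupled by one point [a] that is admissible for [HL] and so small that
     [P a] is within [eps / 2] of [l]; then [P v - l] inherits the closeness of the integral over
     [[a, v]] to [L]. *)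
  assert (HL' := proj2 (is_RInt_gen_Cmod (at_right 0) (Rbar_locally p_infty) psi L) HL
    (mkposreal _ (is_pos_div_2 (mkposreal eps Heps)))).
  destruct HL' as [Q1 Q2 HQ1 [V HQ2] HQ]; simpl in HQ.
  exists (Rmax V 0 + 1); pose proof (Rmax_l V 0); pose proof (Rmax_r V 0).
  split; [lra|]; intros v Hv; simpl in HQ2.
  destruct (Rpower_lt_eps (Re s) (M / Re s) (mkposreal _ (is_pos_div_2 (mkposreal eps Heps))) Hs HM1)
    as [d Hd]; simpl in Hd.
  assert (Hm : 0 < Rmin d 1) by (apply Rmin_pos; [apply d|lra]).
  pose proof (Rmin_l d 1); pose proof (Rmin_r d 1).
  destruct (filter_ex _ (filter_and _ _ HQ1 (at_right_0_lt _ Hm))) as [a [Ha1 Ha2]].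
  destruct (HQ a v Ha1 (HQ2 v ltac:(lra))) as [y [Hy1 Hy2]].
  apply CRInt_unique in Hy1; rewrite HP in Hy1 by lra; subst y.
  replace (P v - l - L)%C with ((P v - P a - L) + (P a - l))%C by ring.
  eapply Rle_trans; [apply Cmod_triangle|].
  assert (H3 := Hl a ltac:(lra)); assert (H4 := Hd a ltac:(lra)); lra. }
destruct (Hinf 1 Rlt_0_1) as [V [HV0 HV]].
set (V1 := Rmax V 1); assert (HV1 : V <= V1) by apply Rmax_l; assert (HV2 : 1 <= V1) by apply Rmax_r.
assert (HPd : forall v, 0 < v -> Cderive P v (psi v)).
{ intros v Hv; apply (is_derive_RInt (V := C_R_NormedModule) psi P 1 v).
  - generalize (open_gt 0 v Hv); apply filter_imp; intros w Hw; apply I; lra.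
  - apply Hpsi; trivial. }
assert (HGd : forall v, 0 < v -> Cderive (fun v => P v - l)%C v (psi v)).
{ intros v Hv; evar_last.
  - apply (is_derive_minus (V := C_R_NormedModule)); [apply HPd; trivial|].
    apply (is_derive_const (V := C_R_NormedModule)).
  - transitivity (psi v - RtoC 0)%C; [reflexivity|ring]. }
destruct (Ccontinuous_bounded (fun v => P v - l)%C 1 V1) as [M1 [HM10 HM1']]; [trivial| |].
{ intros x Hx; eapply Cderive_continuous; apply HGd; lra. }
(* The three entries bound [P - l] on [(0, 1]], on the compact middle piece [[1, V1]], and beyond
   [V1], where it is within 1 of [L]. *)
set (K := Rmax (M / Re s) (Rmax M1 (Cmod L + 1))).
assert (K1 : M / Re s <= K) by apply Rmax_l.
assert (K2 : M1 <= K) by (unfold K; rewrite (Rmax_comm M1); eapply Rle_trans; [apply Rmax_r|apply Rmax_r]).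
assert (K3 : Cmod L + 1 <= K) by (unfold K; eapply Rle_trans; [apply Rmax_r|apply Rmax_r]).
assert (HK0 : 0 <= K) by lra.
assert (Hsmall : forall v, 0 < v <= 1 -> Cmod (P v - l)%C <= K * Rpower v (Re s)).
{ intros v Hv; eapply Rle_trans; [apply Hl; lra|].
  apply Rmult_le_compat_r; [left; apply Rpower_pos|trivial]. }
assert (Hlarge : forall v, 1 <= v -> Cmod (P v - l)%C <= K).
{ intros v Hv; destruct (Rle_or_lt v V1).
  - eapply Rle_trans; [apply HM1'; lra|trivial].
  - replace (P v - l)%C with (P v - l - L + L)%C by ring.
    eapply Rle_trans; [apply Cmod_triangle|].
    assert (H2 := HV v ltac:(lra)); lra. }
exists (fun v => P v - l)%C, K; split; [|split; [|split]].
- exact HGd.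
- intros v Hv; destruct (Rle_or_lt v 1).
  + eapply Rle_trans; [apply Hsmall; lra|].
    rewrite <- (Rmult_1_r K) at 2; apply Rmult_le_compat_l; [trivial|].
    apply Rpower_le_1; lra.
  + apply Hlarge; lra.
- intros v Hv; destruct (Rle_or_lt v 1).
  + apply Hsmall; lra.
  + eapply Rle_trans; [apply Hlarge; lra|].
    rewrite <- (Rmult_1_r K) at 1; apply Rmult_le_compat_l; [trivial|].
    apply Rpower_ge_1; lra.
- exact Hinf.
Qed.

(** * The beta integral *)

Definition beta_kernel (x y : C) (t : R) : C :=
  (Rpow_C t (x - RtoC 1) * Rpow_C (1 - t) (y - RtoC 1))%C.

Lemma continuous_one_minus (t : R) : continuous (fun u => 1 - u) t.
Proof.
apply (continuous_minus (V := R_NormedModule)); [apply continuous_const|apply continuous_id].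
Qed.

Lemma Ccontinuous_one_minus (f : R -> C) (t : R) :
  Ccontinuous f (1 - t) -> Ccontinuous (fun u => f (1 - u)) t.
Proof.
intros H; apply (continuous_comp (fun u => 1 - u) f); [apply continuous_one_minus|exact H].
Qed.

Lemma Ccontinuous_beta_kernel (x y : C) (t : R) :
  0 < t < 1 -> Ccontinuous (beta_kernel x y) t.
Proof.
intros Ht; apply Ccontinuous_mult.
- apply Ccontinuous_Rpow_C; lra.
- apply (Ccontinuous_one_minus (fun u => Rpow_C u (y - RtoC 1)%C)), Ccontinuous_Rpow_C; lra.
Qed.

Lemma beta_kernel_sym (x y : C) (t : R) : beta_kernel x y (1 - t) = beta_kernel y x t.
Proof. unfold beta_kernel; replace (1 - (1 - t)) with t by ring; ring. Qed.

Lemma Cmod_beta_kernel (x y : C) (t : R) :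
  Cmod (beta_kernel x y t) = Rpower t (Re x - 1) * Rpower (1 - t) (Re y - 1).
Proof.
unfold beta_kernel; rewrite Cmod_mult, !Cmod_Rpow_C.
destruct x, y; simpl; f_equal; f_equal; ring.
Qed.

(** This is the source of the shifted Beta parameters: the scaling [rho = v t (1 - t)] in the Mellin
    integral leaves the factor [(t (1 - t))^s]. *)
Lemma beta_kernel_plus (x y s : C) (t : R) :
  0 < t < 1 -> beta_kernel (x + s)%C (y + s)%C t = (beta_kernel x y t * Rpow_C (t * (1 - t)) s)%C.
Proof.
intros Ht; unfold beta_kernel; rewrite Rpow_C_mult by lra.
replace (x + s - RtoC 1)%C with (x - RtoC 1 + s)%C by ring.
replace (y + s - RtoC 1)%C with (y - RtoC 1 + s)%C by ring.
rewrite !Rpow_C_plus; ring.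
Qed.

(** The exponent stays above -1, so comparison with [/ t] gives a bound free of [p]. *)
Lemma Rpower_half_le (t p : R) : / 2 <= t < 1 -> 0 < p -> Rpower t (p - 1) <= 2.
Proof.
intros Ht Hp; apply Rle_trans with (/ t).
- apply Rpower_le_inv; lra.
- rewrite <- (Rinv_inv 2); apply Rinv_le_contravar; lra.
Qed.

(** On each half of the interval one of the two factors is at most 2; passing from product to sum
    separates the two endpoint singularities. *)
Lemma Rpower_beta_le (t p q : R) :
  0 < t < 1 -> 0 < p -> 0 < q ->
  Rpower t (p - 1) * Rpower (1 - t) (q - 1) <=
  2 * (Rpower t (p - 1) + Rpower (1 - t) (q - 1)).
Proof.
intros Ht Hp Hq.
assert (P1 := Rpower_pos t (p - 1)); assert (P2 := Rpower_pos (1 - t) (q - 1)).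
destruct (Rle_or_lt t (/ 2)).
- assert (Rpower (1 - t) (q - 1) <= 2) by (apply Rpower_half_le; lra); nra.
- assert (Rpower t (p - 1) <= 2) by (apply Rpower_half_le; lra); nra.
Qed.

Lemma is_RInt_one_minus {V : NormedModule R_AbsRing} (f : R -> V) (u v : R) (l : V) :
  is_RInt f (1 - v) (1 - u) l -> is_RInt (fun t => f (1 - t)) u v l.
Proof.
intros H; apply is_RInt_swap in H.
replace (1 - u) with (-1 * u + 1) in H by ring.
replace (1 - v) with (-1 * v + 1) in H by ring.
apply is_RInt_comp_lin in H.
apply (is_RInt_scal _ _ _ (-1)) in H.
assert (E : forall w : V, scal (-1) w = opp w).
{ intros w; change (-1) with (opp (@one R_AbsRing)); rewrite scal_opp_l, scal_one; reflexivity. }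
rewrite E, opp_opp in H.
apply is_RInt_ext with (2 := H); intros t _.
rewrite !E, opp_opp; f_equal; ring.
Qed.

(** Each power integrates to at most [1 / p] or [1 / q]. The bound is independent of the truncation
    [u], and [p] may be any lower bound for the actual exponent, which later gives uniformity in
    [n]. *)
Lemma Cmod_beta_int_le (f : R -> C) (p q M u : R) (l : C) :
  0 < p -> 0 < q -> 0 <= M -> 0 < u <= / 4 ->
  (forall t, u <= t <= 1 - u ->
     Cmod (f t) <= M * (Rpower t (p - 1) * Rpower (1 - t) (q - 1))) ->
  CisRInt f u (1 - u) l -> Cmod l <= M * (2 / p + 2 / q).
Proof.
intros Hp Hq HM Hu Hf Hl.
assert (J : forall a, 0 < a ->
  is_RInt (fun t => Rpower t (a - 1)) u (1 - u) ((Rpower (1 - u) a - Rpower u a) / a)).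
{ intros a Ha; apply is_RInt_Rpower; lra. }
assert (B : forall a, 0 < a -> (Rpower (1 - u) a - Rpower u a) / a <= 1 / a).
{ intros a Ha; apply Rmult_le_compat_r; [left; apply Rinv_0_lt_compat; trivial|].
  assert (Rpower (1 - u) a <= 1) by (apply Rpower_le_1; lra).
  assert (H2 := Rpower_pos u a); lra. }
assert (J' : is_RInt (fun t => Rpower (1 - t) (q - 1)) u (1 - u)
   ((Rpower (1 - u) q - Rpower u q) / q)).
{ apply (is_RInt_one_minus (fun t => Rpower t (q - 1))).
  replace (1 - (1 - u)) with u by ring; apply J; trivial. }
eapply Rle_trans.
- apply (Cmod_RInt_le f (fun t => scal (2 * M) (plus (Rpower t (p - 1)) (Rpower (1 - t) (q - 1))))
    u (1 - u) l); [lra| |exact Hl|].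
  + intros t Ht; eapply Rle_trans; [apply Hf; trivial|].
    unfold scal, plus; simpl; unfold mult; simpl.
    assert (H := Rpower_beta_le t p q ltac:(lra) Hp Hq); nra.
  + apply (is_RInt_scal (V := R_NormedModule)).
    apply (is_RInt_plus (V := R_NormedModule)); [apply J; trivial|exact J'].
- unfold scal, plus; simpl; unfold mult; simpl.
  assert (B1 := B p Hp); assert (B2 := B q Hq).
  replace (M * (2 / p + 2 / q)) with (2 * M * (1 / p + 1 / q)) by (field; lra).
  apply Rmult_le_compat_l; lra.
Qed.

Lemma Cmod_beta_tail_le (f : R -> C) (p q M u v : R) (l : C) :
  0 < p -> 0 < q -> 0 <= M -> 0 < u < v -> v <= / 4 ->
  (forall t, u <= t <= v ->
     Cmod (f t) <= M * (Rpower t (p - 1) * Rpower (1 - t) (q - 1))) ->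
  CisRInt f u v l -> Cmod l <= 2 * M / p * Rpower v p.
Proof.
intros Hp Hq HM Hu Hv Hf Hl.
eapply Rle_trans.
- apply (Cmod_RInt_le f (fun t => scal (2 * M) (Rpower t (p - 1))) u v l); [lra| |exact Hl|].
  + intros t Ht; eapply Rle_trans; [apply Hf; trivial|].
    unfold scal; simpl; unfold mult; simpl.
    assert (H := Rpower_half_le (1 - t) q ltac:(lra) Hq).
    assert (P1 := Rpower_pos t (p - 1)); assert (P2 := Rpower_pos (1 - t) (q - 1)).
    rewrite (Rmult_comm 2 M), Rmult_assoc; apply Rmult_le_compat_l; nra.
  + apply (is_RInt_scal (V := R_NormedModule)), is_RInt_Rpower; lra.
- unfold scal; simpl; unfold mult; simpl.
  replace (2 * M / p * Rpower v p) with (2 * M * (Rpower v p / p)) by (field; lra).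
  apply Rmult_le_compat_l; [lra|].
  apply Rmult_le_compat_r; [left; apply Rinv_0_lt_compat; trivial|].
  assert (H2 := Rpower_pos u p); lra.
Qed.

(** The power rate for symmetric truncations allows identities and bounds for [Beta] to be proved on
    [[u, 1 - u]] and passed to the limit. *)
Lemma Beta_rate (x y : C) :
  0 < Re x -> 0 < Re y ->
  exists K sigma, 0 < sigma /\
    @is_RInt_gen C_R_NormedModule (beta_kernel x y) (at_right 0) (at_left 1) (Beta x y) /\
    forall u, 0 < u <= / 4 ->
      Cmod (CRInt (beta_kernel x y) u (1 - u) - Beta x y)%C <= 2 * K * Rpower u sigma.
Proof.
intros Hx Hy.
set (sigma := Rmin (Re x) (Re y)).
assert (Hs : 0 < sigma) by (apply Rmin_pos; trivial).
assert (Hsx : sigma <= Re x) by apply Rmin_l; assert (Hsy : sigma <= Re y) by apply Rmin_r.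
set (K := 2 * 1 / Re x + 2 * 1 / Re y).
assert (K1 : 0 < 2 * 1 / Re x) by (apply Rdiv_lt_0_compat; lra).
assert (K2 : 0 < 2 * 1 / Re y) by (apply Rdiv_lt_0_compat; lra).
(* Quantified over the parameters because the right end is reduced to the left one by [t -> 1 - t],
   which exchanges [x] and [y]. *)
assert (T : forall x y u v l, 0 < Re x -> 0 < Re y -> sigma <= Re x -> 2 * 1 / Re x <= K ->
   0 < u < v -> v <= / 4 ->
   CisRInt (beta_kernel x y) u v l -> Cmod l <= K * Rpower v sigma).
{ intros x' y' u v l Hx' Hy' Hsx' HK Hu Hv Hl; eapply Rle_trans.
  - apply (Cmod_beta_tail_le (beta_kernel x' y') (Re x') (Re y') 1 u v l); trivial; try lra.
    intros t Ht; rewrite Cmod_beta_kernel; lra.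
  - apply Rmult_le_compat; trivial.
    + left; apply Rdiv_lt_0_compat; lra.
    + left; apply Rpower_pos.
    + apply Rpower_antitone; lra. }
destruct (CInt_01_rate (beta_kernel x y) K sigma Hs) as [l [Hl1 Hl2]].
- intros t Ht; apply Ccontinuous_beta_kernel; trivial.
- intros u v l Hu Hv; apply (T x y); trivial; unfold K; lra.
- intros u v l Hu Hv Hl.
  apply (T y x u v l); trivial; [unfold K; lra|].
  apply (is_RInt_one_minus (V := C_R_NormedModule)) in Hl.
  apply (is_RInt_ext (V := C_R_NormedModule)) with (2 := Hl).
  intros t _; apply beta_kernel_sym.
- exists K, sigma.
  assert (E : Beta x y = l).
  { change (Beta x y) with
      (@RInt_gen C_R_CompleteNormedModule (beta_kernel x y) (at_right 0) (at_left 1)).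
    exact (is_RInt_gen_unique (V := C_R_CompleteNormedModule) _ _ Hl1). }
  rewrite E; auto.
Qed.

Lemma Cmod_small_eq0 (w : C) (K sigma : R) :
  0 < sigma -> 0 <= K -> (forall u, 0 < u <= / 4 -> Cmod w <= K * Rpower u sigma) -> w = RtoC 0.
Proof.
intros Hs HK H; apply Cmod_eq_0, Rle_antisym; [|apply Cmod_ge_0].
apply le_epsilon; intros eps Heps.
destruct (Rpower_lt_eps sigma K (mkposreal eps Heps) Hs HK) as [d Hd]; simpl in Hd.
assert (Hm : 0 < Rmin d (/ 4)) by (apply Rmin_pos; [apply d|lra]).
pose proof (Rmin_l d (/ 4)); pose proof (Rmin_r d (/ 4)).
assert (J1 := H (Rmin d (/ 4) / 2) ltac:(lra)).
assert (J2 := Hd (Rmin d (/ 4) / 2) ltac:(lra)); lra.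
Qed.


(** The derivative of [t^x (1 - t)^y] is [x] times the kernel at [(x, y)] minus [x + y] times the
    kernel at [(x + 1, y)], and the boundary values tend to 0 because both real parts are
    positive. *)
Lemma Beta_succ (x y : C) :
  0 < Re x -> 0 < Re y -> ((x + y) * Beta (x + RtoC 1) y = x * Beta x y)%C.
Proof.
intros Hx Hy.
assert (Hx1 : 0 < Re (x + RtoC 1)%C) by (destruct x; simpl in *; lra).
destruct (Beta_rate x y Hx Hy) as [K1 [s1 [Hs1 [_ H1]]]].
destruct (Beta_rate (x + RtoC 1)%C y Hx1 Hy) as [K2 [s2 [Hs2 [_ H2]]]].
set (sigma := Rmin (Rmin s1 s2) (Rmin (Re x) (Re y))).
assert (S1 : sigma <= s1) by (unfold sigma; eapply Rle_trans; apply Rmin_l).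
assert (S2 : sigma <= s2) by (unfold sigma; eapply Rle_trans; [apply Rmin_l|apply Rmin_r]).
assert (S3 : sigma <= Re x) by (unfold sigma; eapply Rle_trans; [apply Rmin_r|apply Rmin_l]).
assert (S4 : sigma <= Re y) by (unfold sigma; eapply Rle_trans; apply Rmin_r).
assert (Hs : 0 < sigma) by (repeat apply Rmin_pos; trivial).
assert (Sign : forall x y K s, (forall u, 0 < u <= / 4 ->
   Cmod (CRInt (beta_kernel x y) u (1 - u) - Beta x y)%C <= 2 * K * Rpower u s) -> 0 <= K).
{ intros x' y' K s' H; specialize (H (/ 4) ltac:(lra)).
  assert (P := Rpower_pos (/ 4) s').
  assert (P2 := Rle_trans _ _ _ (Cmod_ge_0 _) H).
  destruct (Rle_or_lt 0 K); [trivial|nra]. }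
assert (K1p := Sign _ _ _ _ H1); assert (K2p := Sign _ _ _ _ H2).
(* Two truncation errors, weighted as in the identity, plus the two boundary values of
   [t^x (1 - t)^y], each at most [u^sigma]. *)
set (K := Cmod (x + y) * (2 * K2) + Cmod x * (2 * K1) + 2).
assert (P1 := Cmod_ge_0 (x + y)%C); assert (P2 := Cmod_ge_0 x).
assert (HK : 0 <= K).
{ unfold K; apply Rplus_le_le_0_compat; [apply Rplus_le_le_0_compat|lra];
    apply Rmult_le_pos; lra. }
assert (Z : ((x + y) * Beta (x + RtoC 1) y - x * Beta x y = RtoC 0)%C).
2:{ replace ((x + y) * Beta (x + RtoC 1) y)%C with
      (((x + y) * Beta (x + RtoC 1) y - x * Beta x y) + x * Beta x y)%C by ring.
    rewrite Z; ring. }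
apply (Cmod_small_eq0 _ K sigma Hs HK); intros u Hu.
pose (N := fun t => (Rpow_C t x * Rpow_C (1 - t) y)%C).
assert (HN : CisRInt (fun t => (x * beta_kernel x y t - (x + y) * beta_kernel (x + RtoC 1) y t)%C)
   u (1 - u) (N (1 - u)%R - N u)%C).
{ apply CisRInt_derive; [lra| |]; intros t Ht.
  - evar_last.
    + unfold N; apply Cderive_mult; [apply Cderive_Rpow_C; lra|].
      apply (Cderive_comp (fun w => Rpow_C w y) (fun w => 1 - w) t (-1));
        [apply Cderive_Rpow_C; lra|auto_derive; [trivial|ring]].
    + unfold beta_kernel.
      replace (x + RtoC 1 - RtoC 1)%C with x by ring.
      rewrite (Rpow_C_succ t x), (Rpow_C_succ (1 - t) y), RtoC_minus by lra.
      replace (RtoC (-1)) with (- RtoC 1)%C by (rewrite <- RtoC_opp; f_equal; ring).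
      ring.
  - apply (continuous_minus (V := C_R_NormedModule)); apply Ccontinuous_mult;
      try apply continuous_const; apply Ccontinuous_beta_kernel; lra. }
assert (I1 : CisRInt (beta_kernel x y) u (1 - u) (CRInt (beta_kernel x y) u (1 - u))).
{ apply CisRInt_CRInt; [lra|]; intros t Ht; apply Ccontinuous_beta_kernel; lra. }
assert (I2 : CisRInt (beta_kernel (x + RtoC 1)%C y) u (1 - u)
    (CRInt (beta_kernel (x + RtoC 1)%C y) u (1 - u))).
{ apply CisRInt_CRInt; [lra|]; intros t Ht; apply Ccontinuous_beta_kernel; lra. }
assert (I3 := CisRInt_minus _ _ _ _ _ _ (CisRInt_scal _ _ _ x _ I1)
   (CisRInt_scal _ _ _ (x + y)%C _ I2)).
apply CRInt_unique in HN; apply CRInt_unique in I3; cbv beta in I3; rewrite HN in I3.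
specialize (H1 u Hu); specialize (H2 u Hu).
set (A1 := CRInt (beta_kernel x y) u (1 - u)) in *.
set (A2 := CRInt (beta_kernel (x + RtoC 1)%C y) u (1 - u)) in *.
assert (E : ((x + y) * Beta (x + RtoC 1) y - x * Beta x y)%C =
   (- ((x + y) * (A2 - Beta (x + RtoC 1) y)) + x * (A1 - Beta x y) - (N (1 - u)%R - N u))%C).
{ rewrite I3; assert (Q : forall b1 b2 a1 a2 : C, ((x + y) * b2 - x * b1 =
   - ((x + y) * (a2 - b2)) + x * (a1 - b1) - (x * a1 - (x + y) * a2))%C) by (intros; ring).
  apply Q. }
assert (U : forall a, sigma <= a -> Rpower u a <= Rpower u sigma).
{ intros a Ha; apply Rpower_antitone; lra. }
assert (HN1 : Cmod (N (1 - u)) <= Rpower u sigma).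
{ unfold N; rewrite Cmod_mult, !Cmod_Rpow_C; replace (1 - (1 - u)) with u by ring.
  rewrite <- (Rmult_1_l (Rpower u sigma)); apply Rmult_le_compat;
    try (left; apply Rpower_pos); [apply Rpower_le_1; lra|apply U; lra]. }
assert (HN2 : Cmod (N u) <= Rpower u sigma).
{ unfold N; rewrite Cmod_mult, !Cmod_Rpow_C.
  rewrite <- (Rmult_1_r (Rpower u sigma)); apply Rmult_le_compat;
    try (left; apply Rpower_pos); [apply U; lra|apply Rpower_le_1; lra]. }
rewrite E; eapply Rle_trans; [apply Cmod_minus_le|].
assert (T1 : Cmod (N (1 - u)%R - N u)%C <= Rpower u sigma + Rpower u sigma).
{ eapply Rle_trans; [apply Cmod_minus_le|]; lra. }
assert (T2 : Cmod (- ((x + y) * (A2 - Beta (x + RtoC 1) y)) + x * (A1 - Beta x y))%C <=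
  Cmod (x + y) * (2 * K2 * Rpower u sigma) + Cmod x * (2 * K1 * Rpower u sigma)).
{ eapply Rle_trans; [apply Cmod_triangle|]; rewrite Cmod_opp, !Cmod_mult.
  apply Rplus_le_compat; apply Rmult_le_compat_l; trivial.
  - eapply Rle_trans; [exact H2|]; apply Rmult_le_compat_l; [lra|apply U; lra].
  - eapply Rle_trans; [exact H1|]; apply Rmult_le_compat_l; [lra|apply U; lra]. }
unfold K; eapply Rle_trans; [apply Rplus_le_compat; [exact T2|exact T1]|].
right; ring.
Qed.

(** Iterates [Beta_succ]; the cross-multiplied form keeps divisions out of the induction. *)
Lemma Beta_pochhammer (x y : C) (n : nat) :
  0 < Re x -> 0 < Re y ->
  (pochhammer (x + y) n * Beta (x + RtoC (INR n)) y = pochhammer x n * Beta x y)%C.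
Proof.
intros Hx Hy; induction n as [|n IH].
- simpl; replace (x + RtoC 0)%C with x by ring; reflexivity.
- unfold pochhammer in *; simpl Cprod; rewrite S_INR.
  replace (x + RtoC (INR n + 1))%C with (x + RtoC (INR n) + RtoC 1)%C
    by (rewrite RtoC_plus; ring).
  assert (Hn : 0 < Re (x + RtoC (INR n))%C).
  { generalize (pos_INR n); destruct x; simpl in *; lra. }
  replace (x + y + RtoC (INR n))%C with (x + RtoC (INR n) + y)%C by ring.
  rewrite <- Cmult_assoc, Beta_succ, Cmult_assoc, (Cmult_comm _ (x + RtoC (INR n))%C),
    <- Cmult_assoc, IH by assumption; ring.
Qed.

(** * Integration by parts near the endpoints *)

Lemma Rmult3_le (a b c a' b' c' : R) :
  0 <= a -> 0 <= b -> 0 <= c -> a <= a' -> b <= b' -> c <= c' -> a * b * c <= a' * b' * c'.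
Proof.
intros; apply Rmult_le_compat; trivial; [apply Rmult_le_pos; trivial|].
apply Rmult_le_compat; trivial.
Qed.

(* Since [d/dt G (r / (t (1 - t)))] is the kernel at [r / (t (1 - t))] times
   [- r (1 - 2 t) / (t (1 - t))^2], integration by parts trades the conditionally
   convergent kernel for its bounded primitive. *)
Lemma tail_by_parts (phi G : R -> C) (s L : C) (K : R) :
  is_primitive_of_kernel (fun t => Rpow_C t (s - RtoC 1) * phi t)%C (Re s) L G K ->
  (forall t, Ccontinuous phi t) -> 0 < Re s ->
  forall (x y : C) (r u v : R) (l : C),
  0 < Re x -> 0 < Re y -> 0 < r -> 0 < u < v -> v <= / 4 ->
  CisRInt (fun t => beta_kernel x y t * phi (r / (t * (1 - t))%R)%R)%C u v l ->
  Cmod l <= K * ((2 * Cmod (x + s) + 4 * Cmod (y + s) + 8) / Re s + 4)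
    * Rpower r (- Re s) * Rpower v (Re s).
Proof.
intros [HG [HGK _]] Hphi Hs x y r u v l Hx Hy Hr Hu Hv Hl.
assert (HK : 0 <= K).
{ eapply Rle_trans; [apply Cmod_ge_0|apply (HGK 1); lra]. }
set (sg := Re s) in *.
(* Cancels the factor [1 - 2 t] in the derivative of [r / (t (1 - t))]. It blows up at the midpoint,
   hence the restriction [v <= / 4], under which [m] is at most 2. *)
pose (m := fun t => / (1 - 2 * t)).
pose (h := fun t => (Rpow_C t (x + s) * Rpow_C (1 - t) (y + s) * RtoC (m t))%C).
pose (dh := fun t => (((x + s) * Rpow_C t (x + s - RtoC 1) * Rpow_C (1 - t) (y + s)
   - Rpow_C t (x + s) * ((y + s) * Rpow_C (1 - t) (y + s - RtoC 1))) * RtoC (m t)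
   + Rpow_C t (x + s) * Rpow_C (1 - t) (y + s) * RtoC (2 * m t ^ 2))%C).
pose (g := fun t => r / (t * (1 - t))).
pose (q := fun t => (beta_kernel x y t * phi (g t))%C).
assert (Hg0 : forall t, u <= t <= v -> 0 < g t).
{ intros t Ht; apply Rdiv_lt_0_compat; [trivial|apply Rmult_lt_0_compat; lra]. }
assert (Hg : forall t, u <= t <= v -> is_derive g t (- r * (1 - 2 * t) / (t * (1 - t)) ^ 2)).
{ intros t Ht; unfold g; auto_derive.
  - apply Rgt_not_eq, Rmult_lt_0_compat; lra.
  - field; lra. }
assert (Hh : forall t, u <= t <= v -> Cderive h t (dh t)).
{ intros t Ht; evar_last.
  - unfold h; apply Cderive_mult; [apply Cderive_mult|].
    + apply Cderive_Rpow_C; lra.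
    + apply (Cderive_comp (fun w => Rpow_C w (y + s)) (fun w => 1 - w) t (-1));
        [apply Cderive_Rpow_C; lra|auto_derive; [trivial|ring]].
    + apply (Cderive_RtoC m t (2 * m t ^ 2)); unfold m; auto_derive; [lra|field; lra].
  - unfold dh; replace (RtoC (-1)) with (- RtoC 1)%C by (rewrite <- RtoC_opp; f_equal; ring).
    ring. }
assert (cm : forall t, u <= t <= v -> continuous m t).
{ intros t Ht; apply (ex_derive_continuous (V := R_NormedModule)); unfold m; auto_derive; lra. }
assert (cm2 : forall t, u <= t <= v -> continuous (fun t => 2 * m t ^ 2) t).
{ intros t Ht; apply (ex_derive_continuous (V := R_NormedModule)); unfold m; auto_derive; lra. }
assert (c1 : forall a t, u <= t <= v -> Ccontinuous (fun t => Rpow_C t a) t).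
{ intros a t Ht; apply Ccontinuous_Rpow_C; lra. }
assert (c2 : forall a t, u <= t <= v -> Ccontinuous (fun t => Rpow_C (1 - t) a) t).
{ intros a t Ht; apply (Ccontinuous_one_minus (fun w => Rpow_C w a)), Ccontinuous_Rpow_C; lra. }
assert (cdh : forall t, u <= t <= v -> Ccontinuous dh t).
{ intros t Ht; unfold dh.
  apply (continuous_plus (V := C_R_NormedModule)); apply Ccontinuous_mult.
  - apply (continuous_minus (V := C_R_NormedModule)); apply Ccontinuous_mult;
      [apply Ccontinuous_mult; [apply continuous_const|apply c1; trivial]|apply c2; trivial
      |apply c1; trivial|apply Ccontinuous_mult; [apply continuous_const|apply c2; trivial]].
  - apply Ccontinuous_RtoC, cm; trivial.
  - apply Ccontinuous_mult; [apply c1|apply c2]; trivial.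
  - apply (Ccontinuous_RtoC (fun t => 2 * m t ^ 2)), cm2; trivial. }
assert (cg : forall t, u <= t <= v -> continuous g t).
{ intros t Ht; apply (ex_derive_continuous (V := R_NormedModule)); eexists; apply Hg; trivial. }
assert (cG : forall t, u <= t <= v -> Ccontinuous (fun t => G (g t)) t).
{ intros t Ht; apply (continuous_comp g G); [apply cg; trivial|].
  eapply Cderive_continuous; apply HG, Hg0; trivial. }
assert (cq : forall t, u <= t <= v -> Ccontinuous q t).
{ intros t Ht; apply Ccontinuous_mult; [apply Ccontinuous_beta_kernel; lra|].
  apply (continuous_comp g phi); [apply cg; trivial|apply Hphi]. }
(* With [c = t (1 - t)], the kernel at [g t] carries [r^(s-1) c^(1-s)] and [g'] carries
   [- r (1 - 2 t) / c^2]; multiplied by [h] they give exactly [- r^s t^(x-1) (1 - t)^(y-1)]. *)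
assert (Key : forall t, u <= t <= v ->
  Cderive (fun t => (h t * G (g t))%C) t (dh t * G (g t) - Rpow_C r s * q t)%C).
{ intros t Ht; evar_last.
  - apply Cderive_mult; [apply Hh; trivial|].
    apply (Cderive_comp G g); [apply HG, Hg0; trivial|apply Hg; trivial].
  - set (c := t * (1 - t)).
    assert (Hc : 0 < c) by (apply Rmult_lt_0_compat; lra).
    assert (E1 : (h t * RtoC (1 - 2 * t))%C = (beta_kernel x y t * Rpow_C c (s + RtoC 1))%C).
    { unfold h; rewrite <- Cmult_assoc, <- RtoC_mult; unfold m; rewrite Rinv_l by lra.
      unfold c; rewrite Rpow_C_mult by lra; unfold beta_kernel.
      replace (x + s)%C with ((x - RtoC 1) + (s + RtoC 1))%C by ring.
      replace (y + s)%C with ((y - RtoC 1) + (s + RtoC 1))%C by ring.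
      rewrite (Rpow_C_plus t), (Rpow_C_plus (1 - t)); ring. }
    assert (E2 : Rpow_C (g t) (s - RtoC 1) = (Rpow_C r (s - RtoC 1) / Rpow_C c (s - RtoC 1))%C).
    { unfold g; apply Rpow_C_div; trivial. }
    assert (E3 : Rpow_C c (s + RtoC 1) = (RtoC (c ^ 2) * Rpow_C c (s - RtoC 1))%C).
    { rewrite Rpow_C_succ by trivial; replace (s + RtoC 1 - RtoC 1)%C with s by ring.
      rewrite (Rpow_C_succ c s Hc); simpl pow; rewrite !RtoC_mult; ring. }
    assert (E4 : Rpow_C r s = (RtoC r * Rpow_C r (s - RtoC 1))%C) by (apply Rpow_C_succ; trivial).
    assert (Hc2 : RtoC (c ^ 2) <> RtoC 0).
    { intros Q; apply RtoC_inj in Q; revert Q; apply pow_nonzero; lra. }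
    assert (Hn := Rpow_C_neq0 c (s - RtoC 1)%C).
    cbv beta; rewrite E2, E4; unfold q; fold c.
    replace (- r * (1 - 2 * t) / c ^ 2) with (- (r / c ^ 2) * (1 - 2 * t))
      by (field; lra).
    rewrite RtoC_mult, RtoC_opp, RtoC_div by (apply pow_nonzero; lra).
    transitivity (dh t * G (g t) - (h t * RtoC (1 - 2 * t)) * (RtoC r / RtoC (c ^ 2)) *
      (Rpow_C r (s - RtoC 1) / Rpow_C c (s - RtoC 1) * phi (g t)))%C; [|].
    { assert (A : forall a b k w p : C, (a + b * (- k * w * p) = a - b * w * k * p)%C)
        by (intros; ring); apply A. }
    rewrite E1, E3; field; split; assumption. }
assert (Huv : u <= v) by lra.
assert (I0 : CisRInt (fun t => (dh t * G (g t) - Rpow_C r s * q t)%C) u v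
   (h v * G (g v) - h u * G (g u))%C).
{ apply (CisRInt_derive (fun t => (h t * G (g t))%C)); trivial; intros t Ht.
  apply (continuous_minus (V := C_R_NormedModule)); apply Ccontinuous_mult;
    [apply cdh|apply cG|apply continuous_const|apply cq]; trivial. }
set (J := CRInt (fun t => (dh t * G (g t))%C) u v).
assert (I1 : CisRInt (fun t => (dh t * G (g t))%C) u v J).
{ apply CisRInt_CRInt; trivial; intros t Ht; apply Ccontinuous_mult; [apply cdh|apply cG]; trivial. }
assert (I2 := CisRInt_minus _ _ _ _ _ _ I1 (CisRInt_scal _ _ _ (Rpow_C r s) _ Hl)).
apply CRInt_unique in I2; apply CRInt_unique in I0.
change (CRInt (fun t => (dh t * G (g t) - Rpow_C r s * q t)%C) u v
   = (J - Rpow_C r s * l)%C) in I2.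
rewrite I0 in I2; clear I0.
assert (Rs : forall z : C, Re (z + s)%C = Re z + sg) by (intros [? ?]; reflexivity).
assert (Rs1 : forall z : C, Re (z + s - RtoC 1)%C = Re z + sg - 1).
{ intros [? ?]; unfold sg, Re; simpl; ring. }
assert (bt : forall t, u <= t <= v -> Cmod (Rpow_C t (x + s)%C) <= Rpower t sg).
{ intros t Ht; rewrite Cmod_Rpow_C, Rs; apply Rpower_antitone; lra. }
assert (bt1 : forall t, u <= t <= v -> Cmod (Rpow_C t (x + s - RtoC 1)%C) <= Rpower t (sg - 1)).
{ intros t Ht; rewrite Cmod_Rpow_C, Rs1; apply Rpower_antitone; lra. }
assert (bs : forall t, u <= t <= v -> Cmod (Rpow_C (1 - t) (y + s)%C) <= 1).
{ intros t Ht; rewrite Cmod_Rpow_C, Rs; apply Rpower_le_1; lra. }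
assert (bs1 : forall t, u <= t <= v -> Cmod (Rpow_C (1 - t) (y + s - RtoC 1)%C) <= 2).
{ intros t Ht; rewrite Cmod_Rpow_C, Rs1; apply Rpower_half_le; lra. }
assert (bm : forall t, u <= t <= v -> 0 <= m t <= 2).
{ intros t Ht; unfold m; split; [left; apply Rinv_0_lt_compat; lra|].
  rewrite <- (Rinv_inv 2); apply Rinv_le_contravar; lra. }
assert (bm2 : forall t, u <= t <= v -> Cmod (RtoC (m t)) <= 2).
{ intros t Ht; rewrite Cmod_R, Rabs_pos_eq; apply bm; trivial. }
assert (bh : forall t, u <= t <= v -> Cmod (h t) <= 2 * Rpower v sg).
{ intros t Ht; unfold h; rewrite !Cmod_mult.
  replace (2 * Rpower v sg) with (Rpower v sg * 1 * 2) by ring.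
  apply Rmult3_le; try apply Cmod_ge_0; [|apply bs; trivial|apply bm2; trivial].
  eapply Rle_trans; [apply bt; trivial|]; apply Rle_Rpower_l; lra. }
(* The product rule for [h] has three terms. The bounds [m <= 2], [(1 - t)^(y+s-1)] at most 2 and
   [2 m^2 <= 8] give the coefficients 2, 4 and 8. *)
set (D0 := 2 * Cmod (x + s) + 4 * Cmod (y + s) + 8).
assert (bdh : forall t, u <= t <= v -> Cmod (dh t) <= D0 * Rpower t (sg - 1)).
{ intros t Ht.
  assert (P := Rpower_pos t (sg - 1)).
  assert (bt2 : Cmod (Rpow_C t (x + s)%C) <= Rpower t (sg - 1)).
  { eapply Rle_trans; [apply bt; trivial|]; apply Rpower_antitone; lra. }
  assert (A1 : Cmod ((x + s) * Rpow_C t (x + s - RtoC 1) * Rpow_C (1 - t) (y + s))%C <=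
     Cmod (x + s) * Rpower t (sg - 1) * 1).
  { rewrite !Cmod_mult; apply Rmult3_le; try apply Cmod_ge_0; [lra|apply bt1|apply bs]; trivial. }
  assert (A2 : Cmod (Rpow_C t (x + s) * ((y + s) * Rpow_C (1 - t) (y + s - RtoC 1)))%C <=
     Rpower t (sg - 1) * Cmod (y + s) * 2).
  { rewrite Cmult_assoc, !Cmod_mult; apply Rmult3_le; try apply Cmod_ge_0; trivial;
      [lra|apply bs1; trivial]. }
  assert (A3 : Cmod (Rpow_C t (x + s) * Rpow_C (1 - t) (y + s) * RtoC (2 * m t ^ 2))%C <=
     Rpower t (sg - 1) * 1 * 8).
  { rewrite !Cmod_mult; apply Rmult3_le; try apply Cmod_ge_0; trivial; [apply bs; trivial|].
    assert (M := bm t Ht); assert (M2 : 0 <= m t ^ 2 <= 2 ^ 2).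
    { split; [apply pow2_ge_0|apply pow_incr; exact M]. }
    rewrite Cmod_R, Rabs_pos_eq by lra; lra. }
  unfold dh; eapply Rle_trans; [apply Cmod_triangle|]; rewrite Cmod_mult.
  apply Rle_trans with ((Cmod (x + s) * Rpower t (sg - 1) * 1
     + Rpower t (sg - 1) * Cmod (y + s) * 2) * 2 + Rpower t (sg - 1) * 1 * 8).
  - apply Rplus_le_compat; [|exact A3].
    apply Rmult_le_compat; try apply Cmod_ge_0; [|apply bm2; trivial].
    eapply Rle_trans; [apply Cmod_minus_le|]; lra.
  - unfold D0; right; ring. }
assert (HD0 : 0 <= D0).
{ unfold D0; generalize (Cmod_ge_0 (x + s)%C) (Cmod_ge_0 (y + s)%C); lra. }
assert (bJ : Cmod J <= K * D0 * (Rpower v sg / sg)).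
{ eapply Rle_trans.
  - apply (Cmod_RInt_le (fun t => dh t * G (g t))%C
      (fun t => scal (K * D0) (Rpower t (sg - 1))) u v J); [lra| |exact I1|].
    + intros t Ht; rewrite Cmod_mult; unfold scal; simpl; unfold mult; simpl.
      replace (K * D0 * Rpower t (sg - 1)) with ((D0 * Rpower t (sg - 1)) * K) by ring.
      apply Rmult_le_compat; try apply Cmod_ge_0; [apply bdh; trivial|apply HGK, Hg0; trivial].
    + apply (is_RInt_scal (V := R_NormedModule)), is_RInt_Rpower; lra.
  - unfold scal; simpl; unfold mult; simpl.
    apply Rmult_le_compat_l; [apply Rmult_le_pos; trivial|].
    apply Rmult_le_compat_r; [left; apply Rinv_0_lt_compat; trivial|].
    generalize (Rpower_pos u sg); lra. }
assert (bhG : forall t, u <= t <= v -> Cmod (h t * G (g t))%C <= 2 * Rpower v sg * K).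
{ intros t Ht; rewrite Cmod_mult; apply Rmult_le_compat; try apply Cmod_ge_0;
    [apply bh; trivial|apply HGK, Hg0; trivial]. }
assert (El : l = (Rpow_C r (- s) * (J - (h v * G (g v) - h u * G (g u))))%C).
{ rewrite I2, Rpow_C_opp; field; apply Rpow_C_neq0. }
rewrite El, Cmod_mult, Cmod_Rpow_C.
replace (Re (- s)%C) with (- sg) by reflexivity.
(* The two boundary terms, each at most [2 K v^sg], account for the summand 4 in the constant. *)
assert (T : Cmod (J - (h v * G (g v) - h u * G (g u)))%C <=
   K * D0 * (Rpower v sg / sg) + (2 * Rpower v sg * K + 2 * Rpower v sg * K)).
{ eapply Rle_trans; [apply Cmod_minus_le|].
  apply Rplus_le_compat; [exact bJ|].
  eapply Rle_trans; [apply Cmod_minus_le|].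
  apply Rplus_le_compat; apply bhG; lra. }
eapply Rle_trans; [apply Rmult_le_compat_l; [left; apply Rpower_pos|exact T]|].
right; field; unfold sg in *; lra.
Qed.

(** * Mellin transform of the modified beta function *)

(** Left generic in the function: with [phi] it is the integrand of the modified beta function, with
    the primitive [G] it is what integration in [rho] produces. *)
Definition beta_kernel_at (phi : R -> C) (x y : C) (r t : R) : C :=
  (beta_kernel x y t * phi (r / (t * (1 - t))%R)%R)%C.

Lemma one_minus_prod_bounds (t : R) : 0 < t < 1 -> 0 < t * (1 - t) <= / 4.
Proof. intros Ht; split; [apply Rmult_lt_0_compat; lra|]. generalize (pow2_ge_0 (t - / 2)); simpl; lra. Qed.

Lemma one_minus_prod_ge (u t : R) : 0 < u -> u <= t <= 1 - u -> u * (1 - u) <= t * (1 - t).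
Proof.
intros Hu Ht.
assert (0 <= (t - u) * (1 - u - t)) by (apply Rmult_le_pos; lra); lra.
Qed.

Lemma div_prod_pos (r t : R) : 0 < r -> 0 < t < 1 -> 4 * r <= r / (t * (1 - t)).
Proof.
intros Hr Ht; destruct (one_minus_prod_bounds t Ht) as [H1 H2].
unfold Rdiv; rewrite (Rmult_comm 4); apply Rmult_le_compat_l; [lra|].
rewrite <- (Rinv_inv 4); apply Rinv_le_contravar; lra.
Qed.

Lemma continuous_div_prod (r t : R) : 0 < t < 1 -> continuous (fun t => r / (t * (1 - t))) t.
Proof.
intros Ht; apply (ex_derive_continuous (V := R_NormedModule)); auto_derive.
apply Rgt_not_eq, Rmult_lt_0_compat; lra.
Qed.

Lemma Ccontinuous_beta_kernel_at (phi : R -> C) (x y : C) (r t : R) :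
  (forall v, 0 < v -> Ccontinuous phi v) -> 0 < r -> 0 < t < 1 ->
  Ccontinuous (beta_kernel_at phi x y r) t.
Proof.
intros Hphi Hr Ht; apply Ccontinuous_mult; [apply Ccontinuous_beta_kernel; trivial|].
apply (continuous_comp (fun t => r / (t * (1 - t))) phi); [apply continuous_div_prod; trivial|].
apply Hphi; apply Rlt_le_trans with (4 * r); [lra|apply div_prod_pos; trivial].
Qed.

Lemma beta_kernel_at_sym (phi : R -> C) (x y : C) (r t : R) :
  beta_kernel_at phi x y r (1 - t) = beta_kernel_at phi y x r t.
Proof.
unfold beta_kernel_at; rewrite beta_kernel_sym; f_equal; f_equal; f_equal; ring.
Qed.

(** Applies [tail_by_parts] at both ends, the right one after reflection. The constant [A] is fixed
    before [n] and [r]: the power of [r] is bounded on compact subsets of [r > 0], and [n + 1] is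
    absorbed by the hypergeometric coefficients. *)
Lemma beta_kernel_at_rate (phi G : R -> C) (s L : C) (K : R) (x y : C) :
  is_primitive_of_kernel (fun t => Rpow_C t (s - RtoC 1) * phi t)%C (Re s) L G K ->
  (forall t, Ccontinuous phi t) -> 0 < Re s -> 0 < Re x -> 0 < Re y ->
  exists A, 0 <= A /\ forall (n : nat) (r : R), 0 < r ->
  exists l, @is_RInt_gen C_R_NormedModule (beta_kernel_at phi (x + RtoC (INR n))%C y r)
      (at_right 0) (at_left 1) l /\
    forall u, 0 < u <= / 4 ->
      Cmod (CRInt (beta_kernel_at phi (x + RtoC (INR n))%C y r) u (1 - u) - l)%C <=
      A * (INR n + 1) * Rpower r (- Re s) * Rpower u (Re s).
Proof.
intros HG Hphi Hs Hx Hy.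
assert (HK : 0 <= K).
{ destruct HG as [_ [HGK _]]; eapply Rle_trans; [apply Cmod_ge_0|apply (HGK 1); lra]. }
set (sg := Re s) in *.
(* The coefficient 4 on both moduli covers the weights 2 and 4 of [tail_by_parts] in either order;
   [12 (n + 1)] absorbs the constant 8 and the [4 n] coming from the shift of [x]. *)
set (B := (4 * Cmod (x + s) + 4 * Cmod (y + s) + 12) / sg + 4).
assert (Px := Cmod_ge_0 (x + s)%C); assert (Py := Cmod_ge_0 (y + s)%C).
assert (HB : 0 <= B).
{ apply Rplus_le_le_0_compat; [apply Rmult_le_pos; [lra|left; apply Rinv_0_lt_compat; lra]|lra]. }
exists (2 * (K * B)); split; [apply Rmult_le_pos; [lra|apply Rmult_le_pos; trivial]|].
intros n r Hr; assert (Hn := pos_INR n).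
set (xn := (x + RtoC (INR n))%C).
assert (Hxn : 0 < Re xn) by (unfold xn; destruct x; simpl in *; lra).
assert (Cxn : Cmod (xn + s) <= Cmod (x + s) + INR n).
{ replace (xn + s)%C with ((x + s) + RtoC (INR n))%C by (unfold xn; ring).
  eapply Rle_trans; [apply Cmod_triangle|]; rewrite Cmod_R, Rabs_pos_eq by trivial; lra. }
assert (Pxn := Cmod_ge_0 (xn + s)%C).
assert (Bd : forall c d, 0 <= c -> 0 <= d -> c + d <= 4 * Cmod (x + s) + 4 * INR n + 4 * Cmod (y + s) ->
   K * ((c + d + 8) / sg + 4) <= K * B * (INR n + 1)).
{ intros c d Hc Hd Hcd; rewrite Rmult_assoc; apply Rmult_le_compat_l; trivial; unfold B.
  replace (((4 * Cmod (x + s) + 4 * Cmod (y + s) + 12) / sg + 4) * (INR n + 1)) with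
    (((4 * Cmod (x + s) + 4 * Cmod (y + s) + 12) * (INR n + 1)) / sg + 4 * (INR n + 1))
    by (field; lra).
  apply Rplus_le_compat; [|lra].
  apply Rmult_le_compat_r; [left; apply Rinv_0_lt_compat; lra|nra]. }
assert (Hphi' : forall v, 0 < v -> Ccontinuous phi v) by (intros; apply Hphi).
destruct (CInt_01_rate (beta_kernel_at phi xn y r) (K * B * (INR n + 1) * Rpower r (- sg)) sg Hs)
  as [l [Hl1 Hl2]].
- intros t Ht; apply Ccontinuous_beta_kernel_at; trivial.
- intros u v l Hu Hv Hl.
  eapply Rle_trans; [apply (tail_by_parts phi G s L K HG Hphi Hs xn y r u v l); trivial|].
  apply Rmult_le_compat_r; [left; apply Rpower_pos|].
  apply Rmult_le_compat_r; [left; apply Rpower_pos|].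
  apply Bd; lra.
- intros u v l Hu Hv Hl.
  apply (is_RInt_one_minus (V := C_R_NormedModule)) in Hl.
  apply (is_RInt_ext (V := C_R_NormedModule) _ (beta_kernel_at phi y xn r)) in Hl;
    [|intros t _; apply beta_kernel_at_sym].
  eapply Rle_trans; [apply (tail_by_parts phi G s L K HG Hphi Hs y xn r u v l); trivial|].
  apply Rmult_le_compat_r; [left; apply Rpower_pos|].
  apply Rmult_le_compat_r; [left; apply Rpower_pos|].
  apply Bd; lra.
- exists l; split; [exact Hl1|]; intros u Hu.
  eapply Rle_trans; [apply Hl2; trivial|right; ring].
Qed.

(** The exchange of the two integrals on a compact rectangle: [beta_kernel_at G] with shifted
    parameters is a primitive in [r] of the Mellin integrand, so [CisRInt_param] applies. *)
Lemma CRInt_beta_kernel_at_integral (phi G : R -> C) (s L : C) (K : R) (x y : C) (u a b : R) :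
  is_primitive_of_kernel (fun t => Rpow_C t (s - RtoC 1) * phi t)%C (Re s) L G K ->
  (forall t, Ccontinuous phi t) -> 0 < u <= / 4 -> 0 < a <= b ->
  CisRInt (fun r => Rpow_C r (s - RtoC 1) * CRInt (beta_kernel_at phi x y r) u (1 - u))%C a b
    (CRInt (beta_kernel_at G (x + s) (y + s) b) u (1 - u)
     - CRInt (beta_kernel_at G (x + s) (y + s) a) u (1 - u))%C.
Proof.
intros [HG _] Hphi Hu Hab.
set (psi := fun t => (Rpow_C t (s - RtoC 1) * phi t)%C) in *.
assert (Hphi' : forall v, 0 < v -> Ccontinuous phi v) by (intros; apply Hphi).
assert (HGc : forall v, 0 < v -> Ccontinuous G v).
{ intros v Hv; eapply Cderive_continuous; apply HG; trivial. }
assert (Hpsi : forall v, 0 < v -> Ccontinuous psi v).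
{ intros v Hv; apply Ccontinuous_mult; [apply Ccontinuous_Rpow_C; trivial|apply Hphi]. }
assert (Ht01 : forall t, u <= t <= 1 - u -> 0 < t < 1) by (intros; lra).
(* This weight does not involve [r]: the integrand becomes [W t] times [psi (r / (t (1 - t)))], and
   continuity in [r] uniformly in [t] reduces to uniform continuity of [psi]. *)
pose (W := fun t => (beta_kernel (x + s) (y + s) t * RtoC (/ (t * (1 - t))))%C).
assert (EW : forall r t, 0 < r -> 0 < t < 1 ->
  (Rpow_C r (s - RtoC 1) * beta_kernel_at phi x y r t)%C = (W t * psi (r / (t * (1 - t)))%R)%C).
{ intros r t Hr Ht; unfold W, psi, beta_kernel_at; destruct (one_minus_prod_bounds t Ht) as [Hc _].
  rewrite beta_kernel_plus, Rpow_C_div, (Rpow_C_succ (t * (1 - t)) s) by trivial.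
  assert (Hn := Rpow_C_neq0 (t * (1 - t)) (s - RtoC 1)%C).
  assert (E : (RtoC (t * (1 - t)) * RtoC (/ (t * (1 - t))))%C = RtoC 1).
  { rewrite <- RtoC_mult, Rinv_r by lra; reflexivity. }
  transitivity (Rpow_C r (s - RtoC 1) * (beta_kernel x y t * phi (r / (t * (1 - t)))%R) *
    (RtoC (t * (1 - t)) * RtoC (/ (t * (1 - t)))))%C; [rewrite E; ring|field; exact Hn]. }
assert (Hf : forall r t, 0 < r -> u <= t <= 1 - u ->
   Ccontinuous (fun t => Rpow_C r (s - RtoC 1) * beta_kernel_at phi x y r t)%C t).
{ intros r t Hr Ht; apply Ccontinuous_mult; [apply continuous_const|].
  apply Ccontinuous_beta_kernel_at; auto. }
apply (is_RInt_ext (V := C_R_NormedModule)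
  (fun r => CRInt (fun t => Rpow_C r (s - RtoC 1) * beta_kernel_at phi x y r t)%C u (1 - u))).
{ intros r; rewrite Rmin_left, Rmax_right by lra; intros Hr; apply CRInt_unique.
  apply CisRInt_scal, CisRInt_CRInt; [lra|]; intros t Ht.
  apply Ccontinuous_beta_kernel_at; auto; lra. }
apply (CisRInt_param (fun r t => Rpow_C r (s - RtoC 1) * beta_kernel_at phi x y r t)%C
  (fun r => beta_kernel_at G (x + s) (y + s) r) u (1 - u)); trivial; [lra| | |].
- intros r t Hr Ht; destruct (one_minus_prod_bounds t (Ht01 t Ht)) as [Hc _].
  unfold beta_kernel_at at 1; evar_last.
  + apply Cderive_mult; [apply (is_derive_const (V := C_R_NormedModule))|].
    apply (Cderive_comp G (fun r => r / (t * (1 - t))) r (/ (t * (1 - t)))).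
    * apply HG, Rdiv_lt_0_compat; trivial.
    * auto_derive; [trivial|ring].
  + rewrite EW by auto; unfold W.
    transitivity (RtoC 0 * G (r / (t * (1 - t)))%R + beta_kernel (x + s) (y + s) t *
      (RtoC (/ (t * (1 - t))) * psi (r / (t * (1 - t)))%R))%C; [reflexivity|ring].
- intros r eps Hr.
  destruct (Ccontinuous_bounded W u (1 - u)) as [M [HM0 HM]]; [lra| |].
  { intros t Ht; apply Ccontinuous_mult; [apply Ccontinuous_beta_kernel; auto|].
    apply (Ccontinuous_RtoC (fun t => / (t * (1 - t)))).
    apply (ex_derive_continuous (V := R_NormedModule)); auto_derive.
    apply Rgt_not_eq, Rmult_lt_0_compat; lra. }
  set (c0 := u * (1 - u)).
  assert (Hc0 : 0 < c0) by (apply Rmult_lt_0_compat; lra).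
  assert (He : 0 < eps / (M + 1)) by (apply Rdiv_lt_0_compat; [apply eps|lra]).
  (* For [w] in [[r / 2, 2 r]] all the quotients [w / (t (1 - t))] lie in [[r, 2 r / c0]], because
     [c0 <= t (1 - t) <= / 4]. Division by [t (1 - t)] stretches distances by at most [/ c0], hence
     the radius [d * c0]. *)
  destruct (unifcont_normed_1d (V := C_R_NormedModule) psi r (2 * r / c0)) with
    (eps := mkposreal _ He) as [d Hd].
  { intros v Hv; apply Hpsi; lra. }
  assert (Hdel : 0 < Rmin (r / 2) (d * c0)).
  { apply Rmin_pos; [lra|apply Rmult_lt_0_compat; [apply d|trivial]]. }
  exists (mkposreal _ Hdel); intros r' Hr' t Ht.
  unfold ball in Hr'; simpl in Hr'; unfold AbsRing_ball, abs, minus, plus, opp in Hr'; simpl in Hr'.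
  assert (Q1 := Rmin_l (r / 2) (d * c0)); assert (Q2 := Rmin_r (r / 2) (d * c0)).
  assert (Hr'1 := Rlt_le_trans _ _ _ Hr' Q1); assert (Hr'2 := Rlt_le_trans _ _ _ Hr' Q2).
  apply Rabs_def2 in Hr'1.
  destruct (one_minus_prod_bounds t (Ht01 t Ht)) as [Hc Hc4].
  assert (Hcc := one_minus_prod_ge u t ltac:(lra) Ht); fold c0 in Hcc.
  rewrite !EW by (auto; lra).
  replace (W t * psi (r' / (t * (1 - t)))%R - W t * psi (r / (t * (1 - t)))%R)%C with
    (W t * (psi (r' / (t * (1 - t)))%R - psi (r / (t * (1 - t)))%R))%C by ring.
  rewrite Cmod_mult.
  assert (Rg : forall w, r / 2 <= w <= 2 * r -> r <= w / (t * (1 - t)) <= 2 * r / c0).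
  { intros w Hw; split.
    - apply Rle_trans with (4 * w); [lra|apply div_prod_pos; auto; lra].
    - apply Rmult_le_compat; try lra; [left; apply Rinv_0_lt_compat; trivial|].
      apply Rinv_le_contravar; trivial. }
  assert (Hb := Hd (r / (t * (1 - t))) (r' / (t * (1 - t))) (Rg r ltac:(lra)) (Rg r' ltac:(lra))).
  unfold ball_norm in Hb; rewrite norm_Cmod in Hb; simpl in Hb.
  apply Rle_trans with (M * (eps / (M + 1))).
  + apply Rmult_le_compat; try apply Cmod_ge_0; [apply HM; trivial|left; apply Hb].
    unfold ball; simpl; unfold AbsRing_ball, abs, minus, plus, opp; simpl.
    replace (r' / (t * (1 - t)) + - (r / (t * (1 - t)))) with ((r' + - r) / (t * (1 - t)))
      by (field; lra).
    unfold Rdiv; rewrite Rabs_mult, (Rabs_pos_eq (/ _))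
      by (left; apply Rinv_0_lt_compat; trivial).
    apply Rle_lt_trans with (Rabs (r' + - r) * / c0).
    * apply Rmult_le_compat_l; [apply Rabs_pos|apply Rinv_le_contravar; trivial].
    * apply Rmult_lt_reg_r with c0; [trivial|].
      rewrite Rmult_assoc, Rinv_l, Rmult_1_r by lra; exact Hr'2.
  + apply Rle_trans with ((M + 1) * (eps / (M + 1))).
    * apply Rmult_le_compat_r; lra.
    * right; field; lra.
- intros r t Hr Ht; apply Ccontinuous_beta_kernel_at; auto.
Qed.

(** The sequence [/ (n + 4)] serves as truncation point: it tends to 0 inside [(0, / 4]], the range
    of the rate estimates. *)
Lemma eventually_inv_lt (d : R) : 0 < d -> eventually (fun n => / (INR n + 4) < d).
Proof.
intros Hd; destruct (nfloor_ex (/ d)) as [N HN]; [left; apply Rinv_0_lt_compat; trivial|].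
exists N; intros n Hn; apply le_INR in Hn.
rewrite <- (Rinv_inv d); apply Rinv_lt_contravar.
- apply Rmult_lt_0_compat; [apply Rinv_0_lt_compat; trivial|generalize (pos_INR n); lra].
- lra.
Qed.

Lemma inv_INR_4 (n : nat) : 0 < / (INR n + 4) <= / 4.
Proof.
assert (H := pos_INR n); split; [apply Rinv_0_lt_compat; lra|apply Rinv_le_contravar; lra].
Qed.

Lemma CRInt_beta_kernel_at_near (G : R -> C) (s L : C) (K p eps r u : R) (x y : C) :
  (forall v, 0 < v -> Ccontinuous G v) -> 0 < Re s -> 0 < p <= Re x -> 0 < Re y ->
  0 < r -> 0 < u <= / 4 -> 0 <= eps ->
  (forall v, 4 * r <= v -> Cmod (G v - L)%C <= eps) ->
  Cmod (CRInt (beta_kernel_at G (x + s) (y + s) r) u (1 - u)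
        - L * CRInt (beta_kernel (x + s) (y + s)) u (1 - u))%C <=
  eps * (2 / (p + Re s) + 2 / (Re y + Re s)).
Proof.
intros HG Hs Hp Hy Hr Hu Heps HL.
assert (Ht01 : forall t, u <= t <= 1 - u -> 0 < t < 1) by (intros; lra).
assert (I1 : CisRInt (beta_kernel_at G (x + s) (y + s) r) u (1 - u)
   (CRInt (beta_kernel_at G (x + s) (y + s) r) u (1 - u))).
{ apply CisRInt_CRInt; [lra|]; intros t Ht; apply Ccontinuous_beta_kernel_at; auto. }
assert (I2 : CisRInt (beta_kernel (x + s) (y + s)) u (1 - u)
   (CRInt (beta_kernel (x + s) (y + s)) u (1 - u))).
{ apply CisRInt_CRInt; [lra|]; intros t Ht; apply Ccontinuous_beta_kernel; auto. }
assert (I3 := CisRInt_minus _ _ _ _ _ _ I1 (CisRInt_scal _ _ _ L _ I2)).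
refine (Cmod_beta_int_le _ (p + Re s) (Re y + Re s) eps u _ _ _ _ _ _ I3); trivial; try lra.
intros t Ht; cbv beta; unfold beta_kernel_at.
replace (beta_kernel (x + s) (y + s) t * G (r / (t * (1 - t)))%R - L * beta_kernel (x + s) (y + s) t)%C
  with ((G (r / (t * (1 - t)))%R - L) * beta_kernel (x + s) (y + s) t)%C by ring.
rewrite Cmod_mult; apply Rmult_le_compat; try apply Cmod_ge_0.
- apply HL, div_prod_pos; auto.
- rewrite Cmod_beta_kernel.
  replace (Re (x + s)%C) with (Re x + Re s) by (destruct x, s; reflexivity).
  replace (Re (y + s)%C) with (Re y + Re s) by (destruct y, s; reflexivity).
  apply Rmult_le_compat_r; [left; apply Rpower_pos|].
  apply Rpower_antitone; [destruct (Ht01 t Ht); lra|lra].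
Qed.

(** With [c = t (1 - t)], the factor [c^(Re s)] from the shifted kernel cancels the [c^(- Re s)] in
    the bound for [G (r / c)]. What remains is [r^(Re s)] times the integrable unshifted kernel. *)
Lemma CRInt_beta_kernel_at_small (G : R -> C) (s : C) (K p r u : R) (x y : C) :
  (forall v, 0 < v -> Ccontinuous G v) -> 0 < p <= Re x -> 0 < Re y ->
  0 < r -> 0 < u <= / 4 -> 0 <= K ->
  (forall v, 0 < v -> Cmod (G v) <= K * Rpower v (Re s)) ->
  Cmod (CRInt (beta_kernel_at G (x + s) (y + s) r) u (1 - u)) <=
  K * Rpower r (Re s) * (2 / p + 2 / Re y).
Proof.
intros HG Hp Hy Hr Hu HK HGs.
assert (Ht01 : forall t, u <= t <= 1 - u -> 0 < t < 1) by (intros; lra).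
assert (I1 : CisRInt (beta_kernel_at G (x + s) (y + s) r) u (1 - u)
   (CRInt (beta_kernel_at G (x + s) (y + s) r) u (1 - u))).
{ apply CisRInt_CRInt; [lra|]; intros t Ht; apply Ccontinuous_beta_kernel_at; auto. }
refine (Cmod_beta_int_le _ p (Re y) _ u _ _ _ _ _ _ I1); trivial; try lra.
{ apply Rmult_le_pos; [trivial|left; apply Rpower_pos]. }
intros t Ht; unfold beta_kernel_at; destruct (one_minus_prod_bounds t (Ht01 t Ht)) as [Hc _].
rewrite beta_kernel_plus, !Cmod_mult, Cmod_Rpow_C, Cmod_beta_kernel by auto.
set (c := t * (1 - t)) in *.
assert (Hrc : 0 < r / c) by (apply Rdiv_lt_0_compat; trivial).
assert (E : Rpower r (Re s) = Rpower c (Re s) * Rpower (r / c) (Re s)).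
{ rewrite Rpower_mult_distr by trivial; f_equal; field; lra. }
assert (P1 := Rpower_pos t (Re x - 1)); assert (P2 := Rpower_pos (1 - t) (Re y - 1)).
assert (P3 := Rpower_pos c (Re s)).
apply Rle_trans with (Rpower t (Re x - 1) * Rpower (1 - t) (Re y - 1) * Rpower c (Re s)
  * (K * Rpower (r / c) (Re s))).
- apply Rmult_le_compat_l; [|apply HGs; trivial].
  left; repeat apply Rmult_lt_0_compat; trivial.
- rewrite E.
  replace (Rpower t (Re x - 1) * Rpower (1 - t) (Re y - 1) * Rpower c (Re s)
    * (K * Rpower (r / c) (Re s))) with
    (K * (Rpower c (Re s) * Rpower (r / c) (Re s)) * (Rpower t (Re x - 1) * Rpower (1 - t) (Re y - 1)))
    by ring.
  apply Rmult_le_compat_l.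
  + apply Rmult_le_pos; [trivial|left; apply Rmult_lt_0_compat; apply Rpower_pos].
  + apply Rmult_le_compat_r; [lra|].
    apply Rpower_antitone; [destruct (Ht01 t Ht); lra|lra].
Qed.

(** [MB] is known only through its truncation rate. The final error separates the upper end ([eps])
    from the lower end ([a^(Re s)]) and sees [x] only through [p], so it is the same for every shift
    of [x] by [n]. *)
Lemma Mellin_beta_kernel_at (phi G MB : R -> C) (s L : C) (K p A : R) (x y : C) :
  is_primitive_of_kernel (fun t => Rpow_C t (s - RtoC 1) * phi t)%C (Re s) L G K ->
  (forall t, Ccontinuous phi t) -> 0 < Re s -> 0 < p <= Re x -> 0 < Re y ->
  (forall r u, 0 < r -> 0 < u <= / 4 ->
     Cmod (CRInt (beta_kernel_at phi x y r) u (1 - u) - MB r)%C <=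
     A * Rpower r (- Re s) * Rpower u (Re s)) ->
  forall a b eps, 0 < a <= b -> 0 <= eps -> (forall v, 4 * b <= v -> Cmod (G v - L)%C <= eps) ->
  exists E, CisRInt (fun r => Rpow_C r (s - RtoC 1) * MB r)%C a b E /\
    Cmod (E - L * Beta (x + s) (y + s))%C <=
    eps * (2 / (p + Re s) + 2 / (Re y + Re s)) + K * Rpower a (Re s) * (2 / p + 2 / Re y).
Proof.
intros HG Hphi Hs Hp Hy Hrate a b eps Hab Heps Hb.
assert (HGc : forall v, 0 < v -> Ccontinuous G v).
{ destruct HG as [HG _]; intros v Hv; eapply Cderive_continuous; apply HG; trivial. }
assert (HK : 0 <= K).
{ destruct HG as [_ [HGK _]]; eapply Rle_trans; [apply Cmod_ge_0|apply (HGK 1); lra]. }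
assert (HA : 0 <= A).
{ assert (H := Hrate 1 (/ 4) ltac:(lra) ltac:(lra)).
  assert (H1 := Rle_trans _ _ _ (Cmod_ge_0 _) H).
  assert (P := Rmult_lt_0_compat _ _ (Rpower_pos 1 (- Re s)) (Rpower_pos (/ 4) (Re s))).
  rewrite Rmult_assoc in H1; destruct (Rle_or_lt 0 A); [trivial|nra]. }
assert (HAa : 0 <= A / a) by (apply Rmult_le_pos; [trivial|left; apply Rinv_0_lt_compat; lra]).
pose (u := fun n : nat => / (INR n + 4)).
pose (h := fun n => (CRInt (beta_kernel_at G (x + s) (y + s) b) (u n) (1 - u n)
   - CRInt (beta_kernel_at G (x + s) (y + s) a) (u n) (1 - u n))%C).
destruct (CisRInt_uniform_limit
  (fun n r => Rpow_C r (s - RtoC 1) * CRInt (beta_kernel_at phi x y r) (u n) (1 - u n))%C h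
  (fun r => Rpow_C r (s - RtoC 1) * MB r)%C a b) as [E [HE1 HE2]]; [lra| | |].
- intros n; apply (CRInt_beta_kernel_at_integral phi G s L K); trivial; apply inv_INR_4.
(* In the truncation error [r^(Re s - 1)] meets [r^(- Re s)], leaving [A / r <= A / a]: convergence
   is uniform on [[a, b]]. *)
- intros e; destruct (Rpower_lt_eps (Re s) (A / a) e Hs HAa) as [d Hd].
  generalize (eventually_inv_lt d (cond_pos d)); apply filter_imp; intros n Hn r Hr.
  destruct (inv_INR_4 n) as [U1 U2].
  replace (Rpow_C r (s - RtoC 1) * CRInt (beta_kernel_at phi x y r) (u n) (1 - u n)
     - Rpow_C r (s - RtoC 1) * MB r)%C with
    (Rpow_C r (s - RtoC 1) * (CRInt (beta_kernel_at phi x y r) (u n) (1 - u n)%R - MB r))%C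
    by (assert (Q : forall a b c : C, (a * (b - c) = a * b - a * c)%C) by (intros; ring); apply Q).
  rewrite Cmod_mult, Cmod_Rpow_C.
  apply Rle_lt_trans with (A / a * Rpower (u n) (Re s)); [|apply Hd; split; [exact U1|exact Hn]].
  eapply Rle_trans; [apply Rmult_le_compat_l; [left; apply Rpower_pos|
     apply Hrate; [lra|split; [exact U1|exact U2]]]|].
  replace (Re (s - RtoC 1)%C) with (Re s - 1) by (destruct s; simpl; ring).
  rewrite <- !Rmult_assoc; apply Rmult_le_compat_r; [left; apply Rpower_pos|].
  replace (Rpower r (Re s - 1) * A * Rpower r (- Re s)) with (A * / r).
  + apply Rmult_le_compat_l; [trivial|apply Rinv_le_contravar; lra].
  + rewrite (Rmult_comm (Rpower r (Re s - 1))), Rmult_assoc, <- Rpower_plus.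
    replace (Re s - 1 + - Re s) with (Ropp 1) by ring.
    rewrite Rpower_Ropp, Rpower_1 by lra; reflexivity.
- exists E; split; [exact HE2|].
  assert (Hxs : 0 < Re (x + s)%C) by (destruct x, s; simpl in *; lra).
  assert (Hys : 0 < Re (y + s)%C) by (destruct y, s; simpl in *; lra).
  destruct (Beta_rate (x + s)%C (y + s)%C Hxs Hys) as [KB [sB [HsB [_ HB]]]].
  assert (HKB : 0 <= 2 * KB).
  { assert (H := HB (/ 4) ltac:(lra)); assert (P := Rpower_pos (/ 4) sB).
    assert (H1 := Rle_trans _ _ _ (Cmod_ge_0 _) H).
    destruct (Rle_or_lt 0 (2 * KB)); [trivial|nra]. }
  assert (HKL : 0 <= Cmod L * (2 * KB)) by (apply Rmult_le_pos; [apply Cmod_ge_0|trivial]).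
  apply le_epsilon; intros eta Heta.
  set (eta2 := mkposreal _ (is_pos_div_2 (mkposreal eta Heta))).
  destruct (Rpower_lt_eps sB (Cmod L * (2 * KB)) eta2 HsB HKL) as [d Hd].
  assert (F1 := proj2 (filterlim_Cmod eventually h E) HE1 eta2).
  assert (F2 := eventually_inv_lt d (cond_pos d)).
  destruct (filter_ex _ (filter_and _ _ F1 F2)) as [n [N1 N2]].
  destruct (inv_INR_4 n) as [U1 U2].
  assert (T1 := CRInt_beta_kernel_at_near G s L K p eps b (u n) x y HGc Hs Hp Hy
    ltac:(lra) (conj U1 U2) Heps Hb).
  assert (T2 := CRInt_beta_kernel_at_small G s K p a (u n) x y HGc Hp Hy
    ltac:(lra) (conj U1 U2) HK (proj1 (proj2 (proj2 HG)))).
  assert (T3 : Cmod (L * (CRInt (beta_kernel (x + s) (y + s)) (u n) (1 - u n)%R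
     - Beta (x + s) (y + s)))%C <= eta / 2).
  { rewrite Cmod_mult; eapply Rle_trans; [apply Rmult_le_compat_l;
      [apply Cmod_ge_0|apply HB; split; [exact U1|exact U2]]|].
    rewrite <- Rmult_assoc; left; apply Hd; split; [exact U1|exact N2]. }
  unfold h in N1.
  set (Ib := CRInt (beta_kernel_at G (x + s) (y + s) b) (u n) (1 - u n)) in *.
  set (Ia := CRInt (beta_kernel_at G (x + s) (y + s) a) (u n) (1 - u n)) in *.
  set (I0 := CRInt (beta_kernel (x + s) (y + s)) (u n) (1 - u n)) in *.
  set (B := Beta (x + s) (y + s)) in *.
  (* Four errors: the limit defining [E], the replacement of [G] by [L] at the upper end, the
     truncation of the Beta integral, and the lower end. The first and third share the arbitrary
     [eta]. *)
  assert (Q : (E - L * B)%C = (- (Ib - Ia - E) + (Ib - L * I0) + L * (I0 - B) - Ia)%C).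
  { assert (Q : forall e l b ib ia i0 : C, (e - l * b =
      - (ib - ia - e) + (ib - l * i0) + l * (i0 - b) - ia)%C) by (intros; ring); apply Q. }
  rewrite Q; eapply Rle_trans; [apply Cmod_minus_le|].
  assert (N1' : Cmod (- (Ib - Ia - E))%C < eta / 2) by (rewrite Cmod_opp; exact N1).
  assert (Q2 : Cmod (- (Ib - Ia - E) + (Ib - L * I0) + L * (I0 - B))%C <=
    Cmod (- (Ib - Ia - E))%C + Cmod (Ib - L * I0)%C + Cmod (L * (I0 - B))%C).
  { eapply Rle_trans; [apply Cmod_triangle|].
    apply Rplus_le_compat_r, Cmod_triangle. }
  lra.
Qed.

(** * Dominated series *)

Notation Cis_series := (@is_series C_AbsRing C_NormedModule).
Notation Csum_n := (@sum_n (NormedModule.AbelianGroup C_AbsRing C_NormedModule)).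

Lemma Csum_n_diff_le (a : nat -> C) (M : nat -> R) (n m : nat) :
  (forall k, Cmod (a k) <= M k) -> (n <= m)%nat ->
  Cmod (Csum_n a m - Csum_n a n)%C <= sum_n M m - sum_n M n.
Proof.
intros H Hnm; induction Hnm as [|m Hnm IH].
- replace (Csum_n a n - Csum_n a n)%C with (RtoC 0)
    by (assert (Q : forall w : C, RtoC 0 = (w - w)%C) by (intros; ring); apply Q).
  rewrite Cmod_0; lra.
- rewrite !sum_Sn.
  change (plus (Csum_n a m) (a (S m))) with (Csum_n a m + a (S m))%C.
  change (plus (sum_n M m) (M (S m))) with (sum_n M m + M (S m)).
  assert (Q : forall u v w : C, (u + v - w)%C = (u - w + v)%C) by (intros; ring).
  rewrite Q; eapply Rle_trans; [apply Cmod_triangle|].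
  specialize (H (S m)); lra.
Qed.

Lemma sum_n_le_Series (M : nat -> R) (n : nat) :
  (forall k, 0 <= M k) -> ex_series M -> sum_n M n <= Series M.
Proof.
intros H HM.
apply (is_lim_seq_incr_compare (sum_n M) (Series M)).
- apply (Series_correct M HM).
- intros k; rewrite sum_Sn; change (plus (sum_n M k) (M (S k))) with (sum_n M k + M (S k)).
  specialize (H (S k)); lra.
Qed.

Lemma Cseries_tail_le (a : nat -> C) (l : C) (M : nat -> R) (n : nat) :
  (forall k, Cmod (a k) <= M k) -> ex_series M -> Cis_series a l ->
  Cmod (Csum_n a n - l)%C <= Series M - sum_n M n.
Proof.
intros H HM Hl; apply le_epsilon; intros eps Heps.
assert (F1 := proj2 (filterlim_Cmod eventually (Csum_n a) l) Hl (mkposreal eps Heps)).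
assert (F2 : eventually (fun m => (n <= m)%nat)) by (exists n; trivial).
destruct (filter_ex _ (filter_and _ _ F1 F2)) as [m [N1 N2]]; simpl in N1.
assert (D := Csum_n_diff_le a M n m H N2).
assert (P : forall k, 0 <= M k).
{ intros k; eapply Rle_trans; [apply Cmod_ge_0|apply H]. }
assert (S := sum_n_le_Series M m P HM).
assert (Q : forall u v w : C, (u - w)%C = ((v - w) - (v - u))%C) by (intros; ring).
rewrite (Q _ (Csum_n a m)); eapply Rle_trans; [apply Cmod_minus_le|]; lra.
Qed.

Lemma Cseries_le (a : nat -> C) (l : C) (M : nat -> R) :
  (forall k, Cmod (a k) <= M k) -> ex_series M -> Cis_series a l -> Cmod l <= Series M.
Proof.
intros H HM Hl; assert (T := Cseries_tail_le a l M 0 H HM Hl).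
rewrite !sum_O in T; specialize (H O).
assert (Q : forall u v : C, v = (u - (u - v))%C) by (intros; ring).
rewrite (Q (a O) l); eapply Rle_trans; [apply Cmod_minus_le|]; lra.
Qed.

Lemma ex_Cseries_le (a : nat -> C) (M : nat -> R) :
  (forall k, Cmod (a k) <= M k) -> ex_series M -> ex_CSeries a.
Proof. apply (ex_series_le (V := C_CompleteNormedModule) a M). Qed.

Lemma Cis_series_scal (c : C) (a : nat -> C) (l : C) :
  Cis_series a l -> Cis_series (fun n => (c * a n)%C) (c * l)%C.
Proof. apply (is_series_scal (V := C_NormedModule)). Qed.

Lemma Cis_series_minus (a b : nat -> C) (l m : C) :
  Cis_series a l -> Cis_series b m -> Cis_series (fun n => (a n - b n)%C) (l - m)%C.
Proof. apply (is_series_minus (V := C_NormedModule)). Qed.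

Lemma CisRInt_sum_n (f : nat -> R -> C) (e : nat -> C) (a b : R) (n : nat) :
  (forall k, CisRInt (f k) a b (e k)) ->
  CisRInt (fun r => Csum_n (fun k => f k r) n) a b (Csum_n e n).
Proof.
intros H; induction n as [|n IH].
- rewrite sum_O; apply (is_RInt_ext (V := C_R_NormedModule) (f O)); [|apply H].
  intros r _; rewrite sum_O; reflexivity.
- rewrite sum_Sn; apply (is_RInt_ext (V := C_R_NormedModule)
    (fun r => Csum_n (fun k => f k r) n + f (S n) r)%C).
  + intros r _; rewrite sum_Sn; reflexivity.
  + apply CisRInt_plus; [exact IH|apply H].
Qed.

(** Weierstrass test followed by the uniform limit theorem, which also supplies the convergence of
    the integrated series. *)
Lemma CisRInt_series (f : nat -> R -> C) (F : R -> C) (e : nat -> C) (M : nat -> R) (a b : R) :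
  a <= b -> ex_series M ->
  (forall n r, a <= r <= b -> Cmod (f n r) <= M n) ->
  (forall n, CisRInt (f n) a b (e n)) ->
  (forall r, a <= r <= b -> Cis_series (fun n => f n r) (F r)) ->
  exists l, Cis_series e l /\ CisRInt F a b l.
Proof.
intros Hab HM Hf He HF.
apply (CisRInt_uniform_limit (fun n r => Csum_n (fun k => f k r) n) (Csum_n e)); trivial.
- intros n; apply CisRInt_sum_n; trivial.
- intros eps.
  assert (HS := Series_correct M HM).
  assert (H1 : eventually (fun n => Rabs (sum_n M n - Series M) < eps)).
  { apply (proj1 (filterlim_locally (sum_n M) (Series M)) HS eps). }
  generalize H1; apply filter_imp; intros n Hn r Hr.
  eapply Rle_lt_trans; [apply (Cseries_tail_le (fun k => f k r) (F r) M n); auto|].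
  apply Rabs_def2 in Hn; lra.
Qed.

Lemma pochhammer_S (l : C) (n : nat) :
  pochhammer l (S n) = (pochhammer l n * (l + RtoC (INR n)))%C.
Proof. reflexivity. Qed.

Lemma pochhammer_neq0 (l : C) (n : nat) : 0 < Re l -> pochhammer l n <> RtoC 0.
Proof.
intros Hl; induction n as [|n IH].
- intros H; apply RtoC_inj in H; lra.
- rewrite pochhammer_S; apply Cmult_neq_0; trivial.
  intros H; apply (f_equal Re) in H; generalize (pos_INR n); destruct l; simpl in *; lra.
Qed.

Lemma is_lim_seq_inv_S : is_lim_seq (fun n => / (INR n + 1)) 0.
Proof.
apply is_lim_seq_ext with (fun n => / INR (S n)); [intros n; rewrite S_INR; reflexivity|].
apply (is_lim_seq_incr_1 (fun n => / INR n)).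
replace (Finite 0) with (Rbar_inv p_infty) by reflexivity.
apply is_lim_seq_inv; [apply is_lim_seq_INR|discriminate].
Qed.

(* Dominating by strictly positive terms makes d'Alembert's test applicable, whose
   quotients must not vanish. *)
Lemma ex_series_pochhammer (l z : C) :
  Cmod z < 1 ->
  ex_series (fun n => Cmod (pochhammer l n * (Cpow z n / RtoC (INR (fact n))))%C * (INR n + 1)).
Proof.
intros Hz.
(* [La] and [r] are positive even when [l] or [z] vanishes, and [r], midway between [Cmod z] and 1,
   is the limit of the quotients. *)
set (La := Cmod l + 1); set (r := (Cmod z + 1) / 2).
assert (HLa : 0 < La) by (unfold La; generalize (Cmod_ge_0 l); lra).
assert (Hr : 0 < r < 1 /\ Cmod z <= r) by (unfold r; generalize (Cmod_ge_0 z); lra).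
destruct Hr as [Hr Hzr].
pose (d := fun n => Cmod (pochhammer (RtoC La) n) * (r ^ n / INR (fact n)) * (INR n + 1)).
assert (Hmod : forall n, Cmod (RtoC La + RtoC (INR n))%C = La + INR n).
{ intros n; rewrite <- RtoC_plus, Cmod_R, Rabs_pos_eq; [reflexivity|generalize (pos_INR n); lra]. }
assert (Hf : forall n, 0 < INR (fact n)) by (intros n; apply INR_fact_lt_0).
assert (Hpp : forall n, 0 < Cmod (pochhammer (RtoC La) n)).
{ intros n; apply Cmod_gt_0, pochhammer_neq0; exact HLa. }
assert (Hd : forall n, 0 < d n).
{ intros n; unfold d; apply Rmult_lt_0_compat; [|generalize (pos_INR n); lra].
  apply Rmult_lt_0_compat; [apply Hpp|].
  apply Rdiv_lt_0_compat; [apply pow_lt; lra|apply Hf]. }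
assert (Hle : forall n, Cmod (pochhammer l n) <= Cmod (pochhammer (RtoC La) n)).
{ intros n; induction n as [|n IH]; [right; reflexivity|].
  rewrite !pochhammer_S, !Cmod_mult, Hmod; apply Rmult_le_compat; try apply Cmod_ge_0; trivial.
  eapply Rle_trans; [apply Cmod_triangle|].
  rewrite Cmod_R, Rabs_pos_eq by apply pos_INR; unfold La; lra. }
apply (ex_series_le (V := R_CompleteNormedModule)) with (fun n => Rabs (d n)).
- intros n; unfold norm; simpl; unfold abs; simpl.
  assert (Hn := pos_INR n).
  rewrite Rabs_mult, (Rabs_pos_eq (Cmod _)), (Rabs_pos_eq (INR n + 1))
    by (try apply Cmod_ge_0; lra).
  rewrite Rabs_pos_eq by (left; apply Hd).
  unfold d; apply Rmult_le_compat_r; [lra|].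
  rewrite Cmod_mult; apply Rmult_le_compat; try apply Cmod_ge_0; [apply Hle|].
  rewrite Cmod_div by (intros Q; apply RtoC_inj in Q; specialize (Hf n); lra).
  rewrite Cmod_R, (Rabs_pos_eq (INR _)) by (left; apply Hf).
  apply Rmult_le_compat_r; [left; apply Rinv_0_lt_compat, Hf|].
  rewrite Cmod_pow; apply pow_incr; split; [apply Cmod_ge_0|trivial].
- apply (ex_series_DAlembert d r); [lra|intros n; generalize (Hd n); lra|].
  apply is_lim_seq_ext with (fun n => r * (1 + (La - 1) * / (INR n + 1)) * (1 + / (INR n + 1))).
  { intros n; assert (Hn := pos_INR n).
    rewrite Rabs_pos_eq by (left; apply Rdiv_lt_0_compat; apply Hd).
    unfold d; rewrite pochhammer_S, Cmod_mult, Hmod, fact_simpl, mult_INR, !S_INR.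
    simpl pow; specialize (Hpp n); specialize (Hf n).
    assert (0 < r ^ n) by (apply pow_lt; lra).
    field; repeat split; lra. }
  replace (Finite r) with (Finite (r * (1 + (La - 1) * 0) * (1 + 0))) by (f_equal; ring).
  assert (I := is_lim_seq_inv_S).
  apply is_lim_seq_mult'; [apply is_lim_seq_mult'|].
  + apply is_lim_seq_const.
  + apply is_lim_seq_plus'; [apply is_lim_seq_const|].
    apply is_lim_seq_mult'; [apply is_lim_seq_const|exact I].
  + apply is_lim_seq_plus'; [apply is_lim_seq_const|exact I].
Qed.

(** Depends on [x] only through the lower bound [p], so one bound serves all the shifts by [n]. *)
Lemma Cmod_Beta_le (p : R) (x y : C) :
  0 < p <= Re x -> 0 < Re y -> Cmod (Beta x y) <= 2 / p + 2 / Re y.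
Proof.
intros Hp Hy; destruct (Beta_rate x y ltac:(lra) Hy) as [K [sg [Hs [_ H]]]].
assert (HK : 0 <= 2 * K).
{ assert (H1 := Rle_trans _ _ _ (Cmod_ge_0 _) (H (/ 4) ltac:(lra))).
  assert (P := Rpower_pos (/ 4) sg); destruct (Rle_or_lt 0 (2 * K)); [trivial|nra]. }
apply le_epsilon; intros eps Heps.
destruct (Rpower_lt_eps sg (2 * K) (mkposreal eps Heps) Hs HK) as [d Hd]; simpl in Hd.
assert (Hm : 0 < Rmin d (/ 4)) by (apply Rmin_pos; [apply d|lra]).
assert (M1 := Rmin_l d (/ 4)); assert (M2 := Rmin_r d (/ 4)).
set (u := Rmin d (/ 4) / 2).
assert (Hu : 0 < u <= / 4) by (unfold u; lra).
assert (T1 := H u Hu); assert (T2 := Hd u ltac:(unfold u; lra)).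
assert (T3 : Cmod (CRInt (beta_kernel x y) u (1 - u)) <= 1 * (2 / p + 2 / Re y)).
{ apply (Cmod_beta_int_le (beta_kernel x y) p (Re y) 1 u); try lra.
  - intros t Ht; rewrite Cmod_beta_kernel, Rmult_1_l.
    apply Rmult_le_compat_r; [left; apply Rpower_pos|apply Rpower_antitone; lra].
  - apply CisRInt_CRInt; [lra|]; intros t Ht; apply Ccontinuous_beta_kernel; lra. }
assert (Q : forall v w : C, v = (w - (w - v))%C) by (intros; ring).
rewrite (Q (Beta x y) (CRInt (beta_kernel x y) u (1 - u))).
eapply Rle_trans; [apply Cmod_minus_le|]; lra.
Qed.

(** Provides the majorant for summing over [n] on [[a, b]]: the single truncation at [/ 4] is
    bounded directly, and the rate covers the rest. *)
Lemma beta_kernel_at_bounded (phi : R -> C) (s x y : C) (A a b : R) (MB : nat -> R -> C) :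
  (forall t, Ccontinuous phi t) -> 0 < Re s -> 0 < Re x -> 0 < Re y -> 0 < a <= b -> 0 <= A ->
  (forall n r u, 0 < r -> 0 < u <= / 4 ->
     Cmod (CRInt (beta_kernel_at phi (x + RtoC (INR n))%C y r) u (1 - u) - MB n r)%C <=
     A * (INR n + 1) * Rpower r (- Re s) * Rpower u (Re s)) ->
  exists M, 0 <= M /\ forall n r, a <= r <= b -> Cmod (MB n r) <= M * (INR n + 1).
Proof.
intros Hphi Hs Hx Hy Hab HA Hrate.
(* On [[/ 4, 3 / 4]] the product [t (1 - t)] lies between [3 / 16] and [/ 4], so the argument of
   [phi] lies between [4 a] and [16 b / 3 <= 6 b]. *)
destruct (Ccontinuous_bounded phi (4 * a) (6 * b)) as [Mp [HM0 HM]]; [lra|intros; apply Hphi|].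
assert (PA := Rpower_pos a (- Re s)).
assert (HAa : 0 <= A * Rpower a (- Re s)) by (apply Rmult_le_pos; lra).
exists (16 * Mp + A * Rpower a (- Re s)); split; [lra|].
intros n r Hr; assert (Hn := pos_INR n).
assert (T1 := Hrate n r (/ 4) ltac:(lra) ltac:(lra)).
set (xn := (x + RtoC (INR n))%C) in *.
assert (Hxn : Re x <= Re xn) by (unfold xn; destruct x; simpl in *; lra).
assert (T2 : Cmod (CRInt (beta_kernel_at phi xn y r) (/ 4) (1 - / 4)) <= (1 - / 4 - / 4) * (4 * 4 * Mp)).
{ apply (Cmod_RInt_const (beta_kernel_at phi xn y r)); [lra| |].
  - intros t Ht; unfold beta_kernel_at; rewrite Cmod_mult, Cmod_beta_kernel.
    assert (B : forall w p, / 4 <= w <= 1 - / 4 -> 0 < p -> Rpower w (p - 1) <= 4).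
    { intros w p Hw Hp; apply Rle_trans with (/ w); [apply Rpower_le_inv; lra|].
      rewrite <- (Rinv_inv 4); apply Rinv_le_contravar; lra. }
    apply Rmult3_le; try (left; apply Rpower_pos); try apply Cmod_ge_0;
      [apply B; lra|apply B; lra|].
    apply HM; split.
    + apply Rle_trans with (4 * r); [lra|apply div_prod_pos; lra].
    + assert (C1 := one_minus_prod_ge (/ 4) t ltac:(lra) Ht).
      apply Rmult_le_reg_r with (t * (1 - t)); [lra|].
      unfold Rdiv; rewrite Rmult_assoc, Rinv_l by lra; nra.
  - apply CisRInt_CRInt; [lra|]; intros t Ht; apply Ccontinuous_beta_kernel_at; auto; lra. }
assert (T3 : A * (INR n + 1) * Rpower r (- Re s) * Rpower (/ 4) (Re s) <=
   A * Rpower a (- Re s) * (INR n + 1)).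
{ apply Rle_trans with (A * (INR n + 1) * Rpower a (- Re s) * 1); [|right; ring].
  assert (0 <= A * (INR n + 1)) by (apply Rmult_le_pos; lra).
  apply Rmult3_le; try (left; apply Rpower_pos); trivial; try lra.
  - rewrite !Rpower_Ropp; apply Rinv_le_contravar; [apply Rpower_pos|apply Rle_Rpower_l; lra].
  - apply Rpower_le_1; lra. }
assert (Q : forall v w : C, v = (w - (w - v))%C) by (intros; ring).
rewrite (Q (MB n r) (CRInt (beta_kernel_at phi xn y r) (/ 4) (1 - / 4))).
eapply Rle_trans; [apply Cmod_minus_le|].
assert (0 <= Mp * INR n) by (apply Rmult_le_pos; lra).
lra.
Qed.

Lemma Gauss_2F1_Beta (l1 x y z S : C) :
  0 < Re x -> 0 < Re y ->
  Cis_series (fun n => (pochhammer l1 n * (Cpow z n / RtoC (INR (fact n)))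
     * Beta (x + RtoC (INR n)) y)%C) S ->
  S = (Beta x y * Gauss_2F1 l1 x (x + y) z)%C.
Proof.
intros Hx Hy HS.
assert (E : forall n, Beta (x + RtoC (INR n))%C y =
   (pochhammer x n / pochhammer (x + y) n * Beta x y)%C).
{ intros n; assert (Hn : pochhammer (x + y) n <> RtoC 0).
  { apply pochhammer_neq0; destruct x, y; simpl in *; lra. }
  assert (B := Beta_pochhammer x y n Hx Hy).
  transitivity (pochhammer (x + y) n * Beta (x + RtoC (INR n)) y / pochhammer (x + y) n)%C;
    [field; exact Hn|rewrite B; field; exact Hn]. }
(* If [Beta x y = 0], then [E] makes every term 0, so the series equals its own multiple by 0 and
   [S = 0]. Otherwise the series is divided by [Beta x y]. *)
destruct (Ceq_dec (Beta x y) (RtoC 0)) as [Z|Z].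
- assert (H0 : Cis_series (fun n => (RtoC 0 * (pochhammer l1 n *
      (Cpow z n / RtoC (INR (fact n))) * Beta (x + RtoC (INR n)) y))%C) S).
  { apply (is_series_ext (V := C_NormedModule)) with (2 := HS).
    intros n; rewrite E, Z.
    assert (Q : forall u v : C, (u * (v * RtoC 0) = RtoC 0 * (u * (v * RtoC 0)))%C)
      by (intros; ring); apply Q. }
  rewrite <- (CSeries_unique _ _ H0), (CSeries_unique _ _ (Cis_series_scal _ _ _ HS)), Z; ring.
- assert (F : Gauss_2F1 l1 x (x + y) z = (/ Beta x y * S)%C).
  { assert (P : forall n, (/ Beta x y * (pochhammer l1 n *
      (Cpow z n / RtoC (INR (fact n))) * Beta (x + RtoC (INR n)) y) =
      pochhammer l1 n * pochhammer x n / pochhammer (x + y) n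
      * (Cpow z n / RtoC (INR (fact n))))%C).
    { intros n; rewrite E; field; split; [|split]; trivial.
      - intros Q; apply RtoC_inj in Q; generalize (INR_fact_lt_0 n); lra.
      - apply pochhammer_neq0; destruct x, y; simpl in *; lra. }
    apply CSeries_unique, (is_series_ext (V := C_NormedModule) _ _ _ P).
    apply Cis_series_scal, HS. }
  rewrite F; field; exact Z.
Qed.

(** * The modified hypergeometric function *)

Definition MSeries_coef (p q : nat) (kappa mu : nat -> C) (alpha beta : C) (m : nat) : C :=
  (Cprod (fun i => pochhammer (kappa i) m) p / Cprod (fun j => pochhammer (mu j) m) q
   / Gamma (alpha * RtoC (INR m) + beta))%C.

Lemma MSeries_term_coef (p q : nat) (kappa mu : nat -> C) (alpha beta w : C) :
  MSeries_term p q kappa mu alpha beta w =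
  (fun m => MSeries_coef p q kappa mu alpha beta m * Cpow w m)%C.
Proof.
apply functional_extensionality; intros m; unfold MSeries_term, MSeries_coef, Cdiv; ring.
Qed.

Lemma Copp_div_RtoC (r c : R) : c <> 0 -> (- RtoC r / RtoC c)%C = RtoC (- (r / c)).
Proof. intros Hc; rewrite <- RtoC_opp, <- RtoC_div by exact Hc; f_equal; field; exact Hc. Qed.

Lemma filter_prod_0oo (d V : R) :
  0 < d -> filter_prod (at_right 0) (Rbar_locally p_infty)
    (fun ab : R * R => 0 < fst ab < d /\ V < snd ab).
Proof.
intros Hd.
apply (Filter_prod _ _ _ _ _ (at_right_0_lt d Hd) (ex_intro _ V (fun x H => H) :
  Rbar_locally p_infty (fun x => V < x))); simpl; auto.
Qed.

Lemma filter_prod_01 :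
  filter_prod (at_right 0) (at_left 1) (fun ab : R * R => 0 < fst ab < 1 /\ 0 < snd ab < 1).
Proof.
apply (Filter_prod _ _ _ _ _ (at_right_0_lt 1 Rlt_0_1) (at_left_1_lt 1 Rlt_0_1)).
intros u v Hu Hv; simpl; lra.
Qed.

Lemma Rmin_Rmax_pos (a b x : R) : 0 < a -> 0 < b -> Rmin a b < x < Rmax a b -> 0 < x.
Proof. intros Ha Hb; unfold Rmin, Rmax; destruct (Rle_dec a b); lra. Qed.

Lemma MBeta_of_kernel (p q : nat) (kappa mu : nat -> C) (alpha beta x y l : C) (phi : R -> C) (r : R) :
  (forall w, 0 < w -> MSeries p q kappa mu alpha beta (RtoC (- w)) = phi w) -> 0 < r ->
  @is_RInt_gen C_R_NormedModule (beta_kernel_at phi x y r) (at_right 0) (at_left 1) l ->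
  @is_RInt_gen C_R_NormedModule (MBeta_integrand p q kappa mu alpha beta x y (RtoC r))
    (at_right 0) (at_left 1) l.
Proof.
intros Hphi Hr.
apply (is_RInt_gen_ext (V := C_R_NormedModule)).
generalize filter_prod_01; apply filter_imp; intros [a b]; simpl; intros [Ha Hb] t Ht.
assert (Ht01 : 0 < t < 1) by (unfold Rmin, Rmax in Ht; destruct (Rle_dec a b); lra).
destruct (one_minus_prod_bounds t Ht01) as [Hc _].
unfold MBeta_integrand, beta_kernel_at, MBeta_arg.
rewrite Copp_div_RtoC by lra; rewrite Hphi by (apply Rdiv_lt_0_compat; trivial); reflexivity.
Qed.

Lemma MBeta_unique (p q : nat) (kappa mu : nat -> C) (alpha beta x y rho l : C) :
  @is_RInt_gen C_R_NormedModule (MBeta_integrand p q kappa mu alpha beta x y rho)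
    (at_right 0) (at_left 1) l ->
  MBeta p q kappa mu alpha beta x y rho = l.
Proof.
intros H; unfold MBeta, CInt_01.
exact (is_RInt_gen_unique (V := C_R_CompleteNormedModule) _ _ H).
Qed.

Lemma MGamma_kernel (p q : nat) (kappa mu : nat -> C) (alpha beta x : C) (phi : R -> C) :
  (forall w, 0 < w -> MSeries p q kappa mu alpha beta (MGamma_arg (RtoC 0) w) = phi w) ->
  ex_CInt_0oo (MGamma_integrand p q kappa mu alpha beta x (RtoC 0)) ->
  is_CInt_0oo (fun t => Rpow_C t (x - RtoC 1) * phi t)%C (MGamma p q kappa mu alpha beta x (RtoC 0)).
Proof.
intros Hphi HG; unfold MGamma, CInt_0oo, is_CInt_0oo.
assert (H := RInt_gen_correct (V := C_R_CompleteNormedModule) _ HG).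
set (l := RInt_gen _ _ _) in *; clearbody l.
refine (is_RInt_gen_ext (V := C_R_NormedModule) _ _ _ _ H).
generalize (filter_prod_0oo 1 0 Rlt_0_1); apply filter_imp.
intros [a b]; simpl; intros [Ha Hb] t Ht.
apply Rmin_Rmax_pos in Ht; [|lra|lra].
unfold MGamma_integrand; rewrite Hphi by trivial; reflexivity.
Qed.

Theorem theorem4p1
  (p q : nat) (kappa mu : nat -> C)
  (Hkappa : forall i : nat, (i < p)%nat ->
     forall n : nat, kappa i <> Copp (RtoC (INR n)))
  (Hmu : forall j : nat, (j < q)%nat ->
     forall n : nat, mu j <> Copp (RtoC (INR n)))
  (alpha beta : C) (Halpha : (0 < Re alpha)%R)
  (lambda1 lambda2 lambda3 : C)
  (Hlambda2 : (0 < Re lambda2)%R) (Hlambda3 : (Re lambda2 < Re lambda3)%R)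
  (s : C) (Hs : (0 < Re s)%R)
  (z : C) (Hz : (Cmod z < 1)%R)
  (Hconv : ex_MGamma p q kappa mu alpha beta s (RtoC 0)) :
  (forall rho : R, (0 < rho)%R ->
     ex_MGauss p q kappa mu alpha beta lambda1 lambda2 lambda3 z (RtoC rho)) /\
  is_CInt_0oo
    (fun rho : R =>
       (Rpow_C rho (s - 1)
        * MGauss p q kappa mu alpha beta lambda1 lambda2 lambda3 z (RtoC rho))%C)
    (MGamma p q kappa mu alpha beta s (RtoC 0)
     * Beta (lambda2 + s) (lambda3 + s - lambda2)
     / Beta lambda2 (lambda3 - lambda2)
     * Gauss_2F1 lambda1 (lambda2 + s) (lambda3 + 2 * s) z)%C.
Proof.
destruct Hconv as [Hconv HMG].
set (coef := MSeries_coef p q kappa mu alpha beta).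
pose (ser := fun t : R => CSeries (fun m => coef m * Cpow (RtoC t) m)%C).
pose (phi := fun w : R => ser (- w)).
set (Y := (lambda3 - lambda2)%C).
assert (HY : 0 < Re Y) by (unfold Y; destruct lambda2, lambda3; simpl in *; lra).
assert (Harg : forall t, 0 < t -> MGamma_arg (RtoC 0) t = RtoC (- t)).
{ intros t Ht; unfold MGamma_arg, Cdiv; rewrite RtoC_opp; ring. }
assert (Hser : forall t, ex_CSeries (fun m => coef m * Cpow (RtoC t) m)%C /\ Ccontinuous ser t).
{ apply entire_series_neg; intros t Ht.
  assert (H := Hconv t Ht); unfold ex_MSeries in H.
  rewrite MSeries_term_coef, Harg in H by trivial; exact H. }
assert (Hphi : forall t, Ccontinuous phi t).
{ intros t; apply (continuous_comp Ropp ser); [|apply Hser].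
  apply (continuous_opp (V := R_NormedModule)), continuous_id. }
assert (HM : forall w, 0 < w -> MSeries p q kappa mu alpha beta (RtoC (- w)) = phi w).
{ intros w _; unfold MSeries; rewrite MSeries_term_coef; reflexivity. }
set (L := MGamma p q kappa mu alpha beta s (RtoC 0)).
assert (HL : is_CInt_0oo (fun t => Rpow_C t (s - RtoC 1) * phi t)%C L).
{ apply MGamma_kernel; trivial; intros w Hw; rewrite Harg, HM by trivial; reflexivity. }
clearbody L.
destruct (primitive_exists phi s L Hs Hphi HL) as [G [K HG]].
destruct (beta_kernel_at_rate phi G s L K lambda2 Y HG Hphi Hs Hlambda2 HY) as [A [HA Hrate0]].
pose (MB := fun (n : nat) (r : R) =>
  MBeta p q kappa mu alpha beta (lambda2 + RtoC (INR n))%C Y (RtoC r)).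
assert (Hex : forall n r, 0 < r ->
  ex_MBeta p q kappa mu alpha beta (lambda2 + RtoC (INR n))%C Y (RtoC r)).
{ intros n r Hr; split.
  - intros t Ht; destruct (one_minus_prod_bounds t Ht) as [Hc _].
    unfold ex_MSeries, MBeta_arg; rewrite MSeries_term_coef, Copp_div_RtoC by lra; apply Hser.
  - destruct (Hrate0 n r Hr) as [l [Hl _]]; exists l.
    apply MBeta_of_kernel with phi; trivial. }
assert (Hrate : forall n r u, 0 < r -> 0 < u <= / 4 ->
  Cmod (CRInt (beta_kernel_at phi (lambda2 + RtoC (INR n))%C Y r) u (1 - u) - MB n r)%C <=
  A * (INR n + 1) * Rpower r (- Re s) * Rpower u (Re s)).
{ intros n r u Hr Hu; destruct (Hrate0 n r Hr) as [l [Hl1 Hl2]].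
  assert (E : MB n r = l).
  { change (MBeta p q kappa mu alpha beta (lambda2 + RtoC (INR n))%C Y (RtoC r) = l).
    apply MBeta_unique.
    apply MBeta_of_kernel with phi; trivial. }
  rewrite E; apply Hl2; trivial. }
pose (c := fun n => (pochhammer lambda1 n * (Cpow z n / RtoC (INR (fact n))))%C).
assert (Hc : ex_series (fun n => Cmod (c n) * (INR n + 1))) by (apply ex_series_pochhammer; trivial).
set (Cs := Series (fun n => Cmod (c n) * (INR n + 1))).
set (iB := (/ Beta lambda2 Y)%C).
assert (Hterm : forall r n, MGauss_term p q kappa mu alpha beta lambda1 lambda2 lambda3 z (RtoC r) n
   = (iB * (c n * MB n r))%C).
{ intros r n; unfold MGauss_term, MB, c, iB, Y, Cdiv; ring. }
clearbody MB.
(* One domination scheme for three sequences: the modified beta values, the limiting Beta values,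
   and the errors between their Mellin integrals. *)
assert (Hdom : forall M (f : nat -> C), (forall n, Cmod (f n) <= M * (INR n + 1)) ->
  forall n, Cmod (iB * (c n * f n))%C <= Cmod iB * M * (Cmod (c n) * (INR n + 1))).
{ intros M f Hf n; rewrite !Cmod_mult.
  replace (Cmod iB * M * (Cmod (c n) * (INR n + 1))) with
    (Cmod iB * (Cmod (c n) * (M * (INR n + 1)))) by ring.
  apply Rmult_le_compat_l; [apply Cmod_ge_0|].
  apply Rmult_le_compat_l; [apply Cmod_ge_0|apply Hf]. }
assert (Hexs : forall k, ex_series (fun n => k * (Cmod (c n) * (INR n + 1)))).
{ intros k; apply (ex_series_scal (V := R_NormedModule) k _ Hc). }
assert (HexG : forall r, 0 < r ->
  Cis_series (fun n => iB * (c n * MB n r))%C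
    (MGauss p q kappa mu alpha beta lambda1 lambda2 lambda3 z (RtoC r))).
{ intros r Hr.
  (* The degenerate interval [[r, r]] gives the pointwise bound. *)
  destruct (beta_kernel_at_bounded phi s lambda2 Y A r r MB Hphi Hs Hlambda2 HY ltac:(lra) HA Hrate)
    as [M [HM0 HMb]].
  destruct (ex_Cseries_le _ _ (Hdom M (fun n => MB n r) (fun n => HMb n r ltac:(lra)))
    (Hexs (Cmod iB * M))) as [l Hl].
  assert (E : MGauss p q kappa mu alpha beta lambda1 lambda2 lambda3 z (RtoC r) = l).
  { apply CSeries_unique.
    apply (is_series_ext (V := C_NormedModule)) with (2 := Hl).
    intros n; symmetry; apply Hterm. }
  rewrite E; exact Hl. }
split.
{ intros r Hr; split; [intros n; apply Hex; trivial|].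
  eexists; apply (is_series_ext (V := C_NormedModule)) with (2 := HexG r Hr).
  intros n; symmetry; apply Hterm. }
assert (Hxn : forall n, Re lambda2 <= Re (lambda2 + RtoC (INR n))%C).
{ intros n; generalize (pos_INR n); destruct lambda2; simpl; lra. }
assert (Hps : 0 < Re (lambda2 + s)%C) by (destruct lambda2, s; simpl in *; lra).
assert (HYs : 0 < Re (Y + s)%C) by (destruct Y, s; simpl in *; lra).
pose (Bn := fun n => Beta (lambda2 + RtoC (INR n) + s)%C (Y + s)%C).
set (Q1 := 2 / (Re lambda2 + Re s) + 2 / (Re Y + Re s)).
set (Q2 := 2 / Re lambda2 + 2 / Re Y).
assert (HQ1 : 0 < Q1).
{ apply Rplus_lt_0_compat; apply Rdiv_lt_0_compat; lra. }
assert (HQ2 : 0 < Q2).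
{ apply Rplus_lt_0_compat; apply Rdiv_lt_0_compat; lra. }
assert (HBn : forall n, Cmod (Bn n) <= Q1 * (INR n + 1)).
{ intros n; apply Rle_trans with Q1; [|generalize (pos_INR n); nra].
  unfold Q1, Bn; replace (Re Y + Re s) with (Re (Y + s)%C) by (destruct Y, s; reflexivity).
  apply Cmod_Beta_le; trivial; split; [lra|].
  specialize (Hxn n); destruct lambda2, s; simpl in *; lra. }
destruct (ex_Cseries_le _ _ (Hdom Q1 Bn HBn) (Hexs (Cmod iB * Q1))) as [SB HSB].
destruct (ex_Cseries_le (fun n => c n * Bn n)%C (fun n => Q1 * (Cmod (c n) * (INR n + 1))))
  as [S0 HS0]; [|apply Hexs|].
{ intros n; rewrite Cmod_mult.
  replace (Q1 * (Cmod (c n) * (INR n + 1))) with (Cmod (c n) * (Q1 * (INR n + 1))) by ring.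
  apply Rmult_le_compat_l; [apply Cmod_ge_0|apply HBn]. }
assert (ESB : SB = (iB * S0)%C).
{ rewrite <- (CSeries_unique _ _ HSB); apply CSeries_unique, Cis_series_scal, HS0. }
assert (ES0 : S0 = (Beta (lambda2 + s) (Y + s) * Gauss_2F1 lambda1 (lambda2 + s)
   (lambda2 + s + (Y + s)) z)%C).
{ apply Gauss_2F1_Beta; [exact Hps|exact HYs|].
  apply (is_series_ext (V := C_NormedModule)) with (2 := HS0); intros n; unfold c, Bn.
  replace (lambda2 + RtoC (INR n) + s)%C with (lambda2 + s + RtoC (INR n))%C by ring; reflexivity. }
(* The denominator parameter is the sum of the two shifted Beta parameters:
   [(lambda2 + s) + (Y + s) = lambda3 + 2 s]. *)
assert (EL : (L * Beta (lambda2 + s) (lambda3 + s - lambda2) / Beta lambda2 Y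
   * Gauss_2F1 lambda1 (lambda2 + s) (lambda3 + 2 * s) z)%C = (L * SB)%C).
{ rewrite ESB, ES0; unfold Cdiv; fold iB.
  replace (lambda3 + s - lambda2)%C with (Y + s)%C by (unfold Y; ring).
  replace (lambda2 + s + (Y + s))%C with (lambda3 + 2 * s)%C.
  - ring.
  - unfold Y; replace (RtoC 2) with (RtoC 1 + RtoC 1)%C by (rewrite <- RtoC_plus; f_equal; ring).
    ring. }
rewrite EL; clear EL ES0 ESB HS0 S0.
assert (HCs : 0 <= Cs).
{ eapply Rle_trans; [|apply (sum_n_le_Series _ 0); [|exact Hc]].
  - rewrite sum_O; apply Rmult_le_pos; [apply Cmod_ge_0|generalize (pos_INR 0); lra].
  - intros n; apply Rmult_le_pos; [apply Cmod_ge_0|generalize (pos_INR n); lra]. }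
(* [T] bounds the total weight of the series, with 1 added for positivity. Half of [eps] goes to the
   upper end through [eps1 * Q1 * T], half to the lower end through [K * Q2 * T * a^(Re s)]. *)
set (T := Cmod iB * Cs + 1).
assert (HT : 0 < T).
{ unfold T; generalize (Rmult_le_pos _ _ (Cmod_ge_0 iB) HCs); lra. }
assert (HK : 0 <= K).
{ destruct HG as [_ [HGK _]]; eapply Rle_trans; [apply Cmod_ge_0|apply (HGK 1); lra]. }
apply (proj1 (is_RInt_gen_Cmod (at_right 0) (Rbar_locally p_infty) _ _)); intros eps.
set (eps1 := eps / (2 * T * Q1)).
assert (He1 : 0 < eps1).
{ apply Rdiv_lt_0_compat; [apply eps|repeat apply Rmult_lt_0_compat; lra]. }
assert (Heps1 : eps1 * Q1 * T = eps / 2) by (unfold eps1; field; lra).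
clearbody eps1.
destruct (proj2 (proj2 (proj2 HG)) eps1 He1) as [V [HV0 HV]].
destruct (Rpower_lt_eps (Re s) (K * Q2 * T) (pos_div_2 eps) Hs) as [d Hd].
{ repeat apply Rmult_le_pos; lra. }
assert (Hm : 0 < Rmin d 1) by (apply Rmin_pos; [apply d|lra]).
assert (M1 := Rmin_l d 1); assert (M2 := Rmin_r d 1).
(* The threshold 1 on both sides forces [a < b], and [b > V > 0] gives [4 b >= V], as the bound on
   [G - L] requires. *)
generalize (filter_prod_0oo (Rmin d 1) (Rmax V 1) Hm).
refine (@filter_imp _ (filter_prod (at_right 0) (Rbar_locally p_infty)) _ _ _ _).
intros [a b]; simpl; intros [Ha Hb].
assert (V1 := Rmax_l V 1); assert (V2 := Rmax_r V 1).
assert (Hab : 0 < a <= b) by lra.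
pose (delta := eps1 * Q1 + K * Rpower a (Re s) * Q2).
assert (HE : forall n, exists E,
   CisRInt (fun r => Rpow_C r (s - RtoC 1) * MB n r)%C a b E /\ Cmod (E - L * Bn n)%C <= delta).
{ intros n; apply (Mellin_beta_kernel_at phi G (MB n) s L K (Re lambda2) (A * (INR n + 1))
    (lambda2 + RtoC (INR n))%C Y); trivial.
  - split; trivial.
  - intros r u; apply Hrate.
  - lra.
  - intros v Hv; apply HV; lra. }
(* The existential values in [HE] are turned into a sequence by uniqueness of the integral. *)
pose (En := fun n => CRInt (fun r => Rpow_C r (s - RtoC 1) * MB n r)%C a b).
assert (HEn : forall n, CisRInt (fun r => Rpow_C r (s - RtoC 1) * MB n r)%C a b (En n)
   /\ Cmod (En n - L * Bn n)%C <= delta).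
{ intros n; destruct (HE n) as [E [E1 E2]].
  assert (EE : En n = E) by (apply CRInt_unique; exact E1).
  rewrite EE; split; assumption. }
destruct (beta_kernel_at_bounded phi s lambda2 Y A a b MB Hphi Hs Hlambda2 HY Hab HA Hrate)
  as [M [HM0 HMb]].
destruct (Ccontinuous_bounded (fun r => Rpow_C r (s - RtoC 1)) a b) as [Mr [HMr0 HMr]]; [lra| |].
{ intros r Hr; apply Ccontinuous_Rpow_C; lra. }
destruct (CisRInt_series (fun n r => iB * c n * (Rpow_C r (s - RtoC 1) * MB n r))%C
  (fun r => Rpow_C r (s - RtoC 1) *
     MGauss p q kappa mu alpha beta lambda1 lambda2 lambda3 z (RtoC r))%C
  (fun n => iB * c n * En n)%C
  (fun n => Mr * (Cmod iB * M) * (Cmod (c n) * (INR n + 1))) a b) as [I [HI1 HI2]].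
- lra.
- apply Hexs.
- intros n r Hr.
  replace (iB * c n * (Rpow_C r (s - RtoC 1) * MB n r))%C with
    (Rpow_C r (s - RtoC 1) * (iB * (c n * MB n r)))%C by ring.
  rewrite Cmod_mult, Rmult_assoc; apply Rmult_le_compat; try apply Cmod_ge_0; [apply HMr; trivial|].
  apply (Hdom M (fun n => MB n r)); intros k; apply HMb; trivial.
- intros n; apply CisRInt_scal, HEn.
- intros r Hr.
  assert (P : forall n, (Rpow_C r (s - RtoC 1) * (iB * (c n * MB n r)))%C =
     (iB * c n * (Rpow_C r (s - RtoC 1) * MB n r))%C) by (intros n; ring).
  apply (is_series_ext (V := C_NormedModule) _ _ _ P).
  apply Cis_series_scal, HexG; lra.
- exists I; split; [exact HI2|].
  (* The two series are compared term by term; since [delta] does not depend on [n], the difference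
     is at most [Cmod iB * delta * Cs]. *)
  assert (Hdiff := Cis_series_minus _ _ _ _ HI1 (Cis_series_scal L _ _ HSB)).
  assert (Hdelta : 0 <= delta).
  { unfold delta; generalize (Rpower_pos a (Re s)); intros Pa.
    apply Rplus_le_le_0_compat; repeat apply Rmult_le_pos; lra. }
  assert (HIb : Cmod (I - L * SB)%C <=
     Series (fun n => Cmod iB * delta * (Cmod (c n) * (INR n + 1)))).
  { apply (Cseries_le _ _ _) with (3 := Hdiff); [|apply Hexs].
    intros n; replace (iB * c n * En n - L * (iB * (c n * Bn n)))%C with
      (iB * (c n * (En n - L * Bn n)))%C by ring.
    apply (Hdom delta (fun n => En n - L * Bn n)%C); intros k.
    destruct (HEn k) as [_ Hk]; generalize (pos_INR k); nra. }
  rewrite Series_scal_l in HIb; fold Cs in HIb.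
  assert (Da := Hd a ltac:(lra)); simpl in Da.
  assert (F1 : Cmod iB * delta * Cs <= T * delta).
  { unfold T; generalize (Rmult_le_pos _ _ (Cmod_ge_0 iB) HCs); nra. }
  assert (F2 : T * delta = eps1 * Q1 * T + K * Q2 * T * Rpower a (Re s)) by (unfold delta; ring).
  lra.
Qed.
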